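(* Suppose $f:[0,1]^d\to\mathbb{R}$ is smooth in the sense that (i) $f^{(\alpha)}$ exists and is continuous on $[0,1]^d$ for every $\alpha\in\{0,1\}^d$, and (ii) $f^{(\beta)}$ exists and is continuous on $\bar T^{(\alpha)}$ for every $\beta\in J_\alpha$, for every $\alpha\in\{0,1\}^d\setminus\{\mathbf 0\}$. Then $f\in\mathcal{F}^{d,d}_{\infty\text{-mars}}$ and $$V_{\text{mars}}(f)=\sum_{\substack{\beta\in\{0,1,2\}^d\\\max_j\beta_j=2}}\int_{\bar T^{(\beta)}}|f^{(\beta)}| .$$ Furthermore, let $1\le s\le d$. If, in addition, $f^{(\alpha)}=0$ for all $\alpha\in\{0,1\}^d$ with $|\alpha|>s$, then $f\in\mathcal{F}^{d,s}_{\infty\text{-mars}}$ and $$V_{\text{mars}}(f)=\sum_{\substack{\alpha\in\{0,1\}^d\setminus\{\mathbf 0\}\\|\alpha|\le s}}\ \sum_{\beta\in J_\alpha}\int_{\bar T^{(\beta)}}|f^{(\beta)}| .$$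
   Context: $[m]=\{1,\dots,m\}$, $u_+=\max\{u,0\}$, $\mathbf 0=(0,\dots,0)$. Derivatives. For a nonnegative integer vector $\beta$, $f^{(\beta)}=\partial^{\beta_1+\dots+\beta_d}f/\partial x_1^{\beta_1}\cdots\partial x_d^{\beta_d}$; whenever the notation $f^{(\beta)}$ is used it is inherently assumed that $f$ is sufficiently smooth that the derivative does not depend on the order of differentiation (derivatives at boundary points of $[0,1]^d$ being one-sided). For a nonnegative integer vector $\beta\neq\mathbf 0$, $\bar T^{(\beta)}=\prod_{k=1}^d\bar T^{(\beta)}_k$ with $\bar T^{(\beta)}_k=[0,1]$ if $\beta_k=\max_j\beta_j$ and $\bar T^{(\beta)}_k=\{0\}$ otherwise; $\int_{\bar T^{(\beta)}}$ means integration with respect to Lebesgue measure in the coordinates $x_k$ with $\beta_k=\max_j\beta_j$, the remaining coordinates being set to $0$. For $\alpha\in\{0,1\}^d\setminus\{\mathbf 0\}$, $J_\alpha$ is the set of $\beta\in\{0,1,2\}^d$ with $\max_j\beta_j=2$, $\beta_j=0$ if $\alpha_j=0$, and $\beta_j\in\{1,2\}$ if $\alpha_j=1$. Function class. For $\alpha\in\{0,1\}^d$ put $S(\alpha)=\{j\in[d]:\alpha_j=1\}$ and $|\alpha|=|S(\alpha)|$; $t^{(\alpha)}=(t_j,\ j\in S(\alpha))$. For $1\le s\le d$, $a_{\mathbf 0}\in\mathbb{R}$ and a collection $\{\nu_\alpha\}$ in which, for each $\alpha\in\{0,1\}^d\setminus\{\mathbf 0\}$ with $|\alpha|\le s$,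 $\nu_\alpha$ is a finite (Borel) signed measure on $[0,1)^{|\alpha|}$ (coordinates indexed by $S(\alpha)$), define on $[0,1]^d$ $$f_{a_{\mathbf 0},\{\nu_\alpha\}}(x_1,\dots,x_d)=a_{\mathbf 0}+\sum_{\substack{\alpha\in\{0,1\}^d\setminus\{\mathbf 0\}\\|\alpha|\le s}}\int_{[0,1)^{|\alpha|}}\prod_{j\in S(\alpha)}(x_j-t_j)_+\,d\nu_\alpha(t^{(\alpha)}).$$ $\mathcal{F}^{d,s}_{\infty\text{-mars}}$ is the class of all such functions. The complexity of $f=f_{a_{\mathbf 0},\{\nu_\alpha\}}$ is $V_{\text{mars}}(f)=\sum_{\alpha\in\{0,1\}^d\setminus\{\mathbf 0\},\,|\alpha|\le s}|\nu_\alpha|\big([0,1)^{|\alpha|}\setminus\{\mathbf 0\}\big)$, where $|\nu|$ is the (total) variation measure of $\nu$; this is well defined because $a_{\mathbf 0}$ and the $\nu_\alpha$ are uniquely determined by $f$. *)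

(* Defs.v *)
From HB Require Import structures.
From mathcomp Require Import all_boot all_order all_algebra.
From mathcomp Require Import all_classical all_reals all_analysis.

Set Implicit Arguments.
Unset Strict Implicit.
Unset Printing Implicit Defensive.

Import Order.TTheory GRing.Theory Num.Theory.
Import numFieldNormedType.Exports.

Local Open Scope classical_set_scope.
Local Open Scope ring_scope.

(* [n.-tuple (measurableTypeR R)] carries the product of the Borel
   sigma-algebras, so [euclid R n] is R^n with its Borel sets. *)
Notation euclid R n := (n.-tuple (measurableTypeR R)).

Section lebesgue_tuple.
Context {R : realType}.

Definition cons_pair n (p : measurableTypeR R * euclid R n) : euclid R n.+1 :=
  [tuple of p.1 :: p.2].

(* Lebesgue measure on R^n is the n-fold product of the one-dimensional one;
   on the one-point space R^0 it is the unit mass. *)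
Fixpoint lebesgue_tuple n : set (euclid R n) -> \bar R :=
  if n is m.+1 return set (euclid R n) -> \bar R
  then pushforward (@lebesgue_measure R \x @lebesgue_tuple m)%E (@cons_pair m)
  else dirac ([tuple] : euclid R 0).

Lemma measurable_cons_pair n : measurable_fun setT (@cons_pair n).
Proof. exact: measurable_cons. Qed.

Section lebesgue_cons.
Variables (n : nat) (mu : {sigma_finite_measure set (euclid R n) -> \bar R}).

Let lmu := (@lebesgue_measure R \x mu)%E.

Definition lebesgue_cons : set (euclid R n.+1) -> \bar R :=
  pushforward lmu (@cons_pair n).

Let push_lmu := measure_function_pushforward__canonical__measure_function_Measure
  lmu (@measurable_cons_pair n).

Let lebesgue_cons0 : lebesgue_cons set0 = 0%E.
Proof. exact: (@measure0 _ _ _ push_lmu). Qed.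

Let lebesgue_cons_ge0 A : (0 <= lebesgue_cons A)%E.
Proof. exact: (@measure_ge0 _ _ _ push_lmu). Qed.

Let lebesgue_cons_sigma_additive : semi_sigma_additive lebesgue_cons.
Proof. exact: (@measure_semi_sigma_additive _ _ _ push_lmu). Qed.

HB.instance Definition _ := isMeasure.Build _ _ _ lebesgue_cons
  lebesgue_cons0 lebesgue_cons_ge0 lebesgue_cons_sigma_additive.

Let lebesgue_cons_sigma_finite : sigma_finite setT lebesgue_cons.
Proof.
have /sigma_finiteP[F [TF ndF Foo]] := sigma_finiteT (@lebesgue_measure R).
have /sigma_finiteP[G [TG ndG Goo]] := sigma_finiteT mu.
pose unc (t : euclid R n.+1) : measurableTypeR R * euclid R n :=
  (thead t, [tuple of behead t]).
have uncK (p : measurableTypeR R * euclid R n) : unc (cons_pair p) = p.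
  by case: p => a t; congr pair; exact/val_inj.
have munc : measurable_fun setT unc.
  apply/measurable_fun_pair; first exact: measurable_tnth.
  exact: measurable_behead.
exists (fun k => unc @^-1` (F k `*` G k)).
  apply/seteqP; split=> // t _; rewrite -preimage_bigcup /=.
  have [i _ Fi] : (\bigcup_i F i) (unc t).1 by rewrite -TF.
  have [j _ Gj] : (\bigcup_i G i) (unc t).2 by rewrite -TG.
  exists (maxn i j) => //; split.
    by move: Fi; apply/subsetPset/ndF/leq_maxl.
  by move: Gj; apply/subsetPset/ndG/leq_maxr.
move=> k; have [mF Fk] := Foo k; have [mG Gk] := Goo k; split.
  by rewrite -[X in measurable X]setTI; apply: munc => //; exact: measurableX.
rewrite /lebesgue_cons /pushforward -comp_preimage.
rewrite (_ : unc \o @cons_pair n = id); last exact/funext.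
by rewrite preimage_id /lmu [ltLHS]product_measure1E// lte_mul_pinfty// ge0_fin_numE.
Qed.

HB.instance Definition _ := Measure_isSigmaFinite.Build _ _ _ lebesgue_cons
  lebesgue_cons_sigma_finite.

End lebesgue_cons.

Lemma lebesgue_tuple_spec n :
  exists mu : {sigma_finite_measure set (euclid R n) -> \bar R},
    lebesgue_tuple (n := n) = mu.
Proof.
elim: n => [|n [mu emu]].
  by exists (dirac ([tuple] : euclid R 0)).
by exists (lebesgue_cons mu); rewrite /= emu.
Qed.

Section lebesgue_tuple_measure.
Variable n : nat.

Let lebesgue_tuple0 : lebesgue_tuple (n := n) set0 = 0%E.
Proof. by have [mu ->] := lebesgue_tuple_spec n; exact: measure0. Qed.

Let lebesgue_tuple_ge0 A : (0 <= lebesgue_tuple (n := n) A)%E.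
Proof. by have [mu ->] := lebesgue_tuple_spec n; exact: measure_ge0. Qed.

Let lebesgue_tuple_sigma_additive : semi_sigma_additive (lebesgue_tuple (n := n)).
Proof.
by have [mu ->] := lebesgue_tuple_spec n; exact: measure_semi_sigma_additive.
Qed.

HB.instance Definition _ := isMeasure.Build _ _ _ (@lebesgue_tuple n)
  lebesgue_tuple0 lebesgue_tuple_ge0 lebesgue_tuple_sigma_additive.

Let lebesgue_tuple_sigma_finite : sigma_finite setT (@lebesgue_tuple n).
Proof. by have [mu ->] := lebesgue_tuple_spec n; exact: sigma_finiteT. Qed.

HB.instance Definition _ := Measure_isSigmaFinite.Build _ _ _ (@lebesgue_tuple n)
  lebesgue_tuple_sigma_finite.

End lebesgue_tuple_measure.
End lebesgue_tuple.

Section signed_measure.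
Context d (T : measurableType d) (R : realType).
Variable nu : {charge set T -> \bar R}.

Lemma hahn_sets_ex : exists PN : set T * set T, hahn_decomposition nu PN.1 PN.2.
Proof. by have [P [N PN]] := Hahn_decomposition nu; exists (P, N). Qed.

(* The Jordan decomposition does not depend on the chosen Hahn sets. *)
Definition hahn_choice := projT2 (cid hahn_sets_ex).

Definition charge_integral (D : set T) (g : T -> R) : R :=
  \int[jordan_pos hahn_choice]_(t in D) g t -
  \int[jordan_neg hahn_choice]_(t in D) g t.

Definition charge_tv : set T -> \bar R := charge_variation hahn_choice.

End signed_measure.

Section mars.
Context {R : realType} {d : nat}.
Implicit Types (f g : 'rV[R]_d -> R) (x : 'rV[R]_d) (j : 'I_d).

Definition unit_cube : set 'rV[R]_d := [set x | forall k, 0 <= x 0 k <= 1].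

Definition update x j (u : R) : 'rV[R]_d :=
  \row_k (if k == j then u else x 0 k).

Definition diff_quotient j f x (u : R) : R :=
  (f (update x j u) - f x) / (u - x 0 j).

(* Only values [u] in [0, 1] are used, so that partial derivatives are
   one-sided at the boundary of the cube, and values of [f] outside the cube
   are irrelevant. *)
Definition partial_filter j x : set_system R :=
  within `[0, 1] ((x 0 j)^').

Definition has_partial j f x : Prop :=
  cvg (diff_quotient j f x @ partial_filter j x).

Definition partial j f x : R :=
  lim (diff_quotient j f x @ partial_filter j x).

(* The last coordinate of the list is differentiated first. *)
Definition iter_partial (s : seq 'I_d) f : 'rV[R]_d -> R := foldr partial f s.

Section multi_index.
Variable k : nat.
Implicit Type b : {ffun 'I_d -> 'I_k}.

Definition deriv_order b (s : seq 'I_d) : Prop :=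
  forall j, count_mem j s = b j :> nat.

Definition increasing_order b : seq 'I_d :=
  flatten [seq nseq (b j) j | j <- enum 'I_d].

(* f^(b) *)
Definition mderiv b f : 'rV[R]_d -> R := iter_partial (increasing_order b) f.

(* f^(b) exists on [A]: the successive partial derivatives exist on [A] for
   every order of differentiation, and the result is the same for all orders. *)
Definition mderiv_exists b (A : set 'rV[R]_d) f : Prop :=
  (forall s1 j s2, deriv_order b (s1 ++ j :: s2) ->
     forall x, A x -> has_partial j (iter_partial s2 f) x) /\
  (forall s1 s2, deriv_order b s1 -> deriv_order b s2 ->
     forall x, A x -> iter_partial s1 f x = iter_partial s2 f x).

Definition mderiv_continuous b (A : set 'rV[R]_d) f : Prop :=
  mderiv_exists b A f /\ {within A, continuous (mderiv b f)}.

Definition max_order b : nat := (\max_(j < d) b j)%N.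

Definition max_coords b : {set 'I_d} := [set j | b j == max_order b :> nat].

(* \bar T^(b) *)
Definition face b : set 'rV[R]_d :=
  [set x | forall j : 'I_d,
    if j \in max_coords b then (0 <= x 0 j <= 1 : Prop) else x 0 j = 0].

(* The point whose coordinates in [A] are those of [t], in increasing order,
   and whose other coordinates are 0: for [j \notin A], [index j (enum A)] is
   [#|A|], so that [nth] returns its default value. *)
Definition extend0 (A : {set 'I_d}) (t : euclid R #|A|) : 'rV[R]_d :=
  \row_j nth 0 (t : seq R) (index j (enum A)).

(* The integral of |g| over \bar T^(b). *)
Definition face_integral_abs b g : \bar R :=
  (\int[@lebesgue_tuple R #|max_coords b|]_(t in
      [set t : euclid R #|max_coords b| | forall i, (0 <= (tnth t i : R) <= 1)%R])
    (`|g (extend0 t)|%R)%:E)%E.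

End multi_index.

Implicit Type a : {ffun 'I_d -> 'I_2}.

(* S(a) *)
Definition support_set a : {set 'I_d} := [set j | a j == 1%N :> nat].

Definition nonzero a : bool := [exists j, a j != 0%N :> nat].

(* J_a *)
Definition Jset a : {set {ffun 'I_d -> 'I_3}} :=
  [set b : {ffun 'I_d -> 'I_3} | (max_order b == 2%N) &&
    [forall j, if j \in support_set a then (b j == 1%N :> nat) || (b j == 2%N :> nat)
               else b j == 0%N :> nat]].

Definition half_open_cube n : set (euclid R n) :=
  [set t | forall i, 0 <= (tnth t i : R) < 1].

Definition origin n : euclid R n := [tuple of nseq n (0 : R)].

(* The coordinate of [t] attached to the [i]-th element of S(a) (in increasing
   order, [enum_val i]) is [tnth t i].  A finite signed measure on [0,1)^|a| is
   given by a charge on R^|a| of which only the values on subsets of [0,1)^|a|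
   matter. *)
Definition charge_family : Type :=
  forall a, {charge set (euclid R #|support_set a|) -> \bar R}.

Definition mars_fun (s : nat) (a0 : R) (nu : charge_family) x : R :=
  a0 + \sum_(a : {ffun 'I_d -> 'I_2} | nonzero a && (#|support_set a| <= s)%N)
    charge_integral (nu a) (@half_open_cube #|support_set a|)
      (fun t => \prod_(i < #|support_set a|)
         Num.max (x 0 (enum_val i) - (tnth t i : R)) 0).

Definition mars_represents s f (a0 : R) (nu : charge_family) : Prop :=
  forall x, unit_cube x -> f x = mars_fun s a0 nu x.

(* The restriction of [f] to the cube belongs to the class F^{d,s}. *)
Definition mars_class s f : Prop := exists (a0 : R) nu, mars_represents s f a0 nu.

Definition mars_complexity s (nu : charge_family) : \bar R :=
  (\sum_(a : {ffun 'I_d -> 'I_2} | nonzero a && (#|support_set a| <= s)%N)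
    charge_tv (nu a)
      (@half_open_cube #|support_set a| `\ origin #|support_set a|))%E.

(* The complexity of the representation of [f] in F^{d,s}: [a0] and the
   restrictions of the [nu a] to [0,1)^|a| are determined by [f]. *)
Definition Vmars s f : \bar R :=
  get [set v | exists (a0 : R) nu,
    mars_represents s f a0 nu /\ v = mars_complexity s nu].

End mars.

(* Main.v *)
Require Import Defs.
From HB Require Import structures.
From mathcomp Require Import all_boot all_order all_algebra.
From mathcomp Require Import finmap lra ring.
From mathcomp Require Import all_classical all_reals all_analysis.
From mathcomp Require Import measurable_realfun.

(** The fundamental theorem of calculus in each variable writes [f x] as the
sum over [S] of the integrals over the boxes [[0, x_j]] ([j] in [S]) of the
mixed derivative of [f] along [S], taken at points supported on [S].  On that
face the integrated form
[\int_0^x phi = x * phi 0 + \int_0^x (x - u) * phi' u], again in each variable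
of [S], turns such an integral into a sum over [A] included in [S] of integrals
of [\prod_(j in S) max (x_j - t_j) 0] against the derivative of order 2 along
[A] and 1 along [S \ A], where [t] ranges over the face spanned by [A].  So [f]
is represented by measures [nu_S] that have, for each [A] included in [S], a
density on the relatively open face spanned by [A].  These faces are disjoint:
the total variation of [nu_S] outside the origin is the sum over nonempty [A] of
the integrals of the absolute values of the densities.

The representing measures are unique: setting coordinates to 0 isolates one [S]
at a time (induction on [#|S|]), difference quotients of the hinges
[max (x_j - t_j) 0] tend boundedly to indicators of [[0, x_j[], and boxes
generate the Borel sets. *)

Set Implicit Arguments.
Unset Strict Implicit.
Unset Printing Implicit Defensive.

Import Order.TTheory GRing.Theory Num.Theory.
Import numFieldNormedType.Exports.
Import HBNNSimple.

Local Open Scope classical_set_scope.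
Local Open Scope ring_scope.

(** * Integration of bounded measurable functions against finite measures *)

(** All faces are treated inside one space: the face spanned by [A] carries the product of Lebesgue
    measure on [0, 1] in the coordinates of [A] and of the Dirac mass at 0 in the others. A boundary
    term such as [x * phi 0] is then itself an integral, both one-dimensional formulas split one
    integral into a Dirac term and a Lebesgue term, and a single induction on the dimension yields
    both expansions. In exchange, integrands must make sense on the whole space, so derivatives are
    cut off outside the closed cube. Derivatives of order 2 along [A] and 1 along [S \ A] are
    controlled only on the face of [S]. This forces two stages: the second one starts once the
    coordinates outside [S] are 0. For empty [A] the piece is a point mass at the origin, which the
    complexity discards. For nonempty [A] the multi-index has maximum 2, reached exactly on [A], so
    its integration domain is the closed face of [A], equal to the open one up to a null set.
    [Vmars] picks some representation by choice; uniqueness is what allows its value to be computed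
    from the explicit one. *)

Definition bounded_measurable d (T : measurableType d) (R : realType)
  (g : T -> R) := measurable_fun setT g /\ exists M : R, forall x, `|g x| <= M.

Section bounded_measurable.
Context d (T : measurableType d) (R : realType).
Implicit Types (g h : T -> R) (c : R).
Local Notation bm := (@bounded_measurable d T R).

Lemma bm_cst c : bm (fun=> c).
Proof. by split; [exact: measurable_cst|exists `|c|]. Qed.

Lemma bmD g h : bm g -> bm h -> bm (fun x => g x + h x).
Proof.
move=> [mg [M gM]] [mh [N hN]]; split; first exact: measurable_funD.
by exists (M + N) => x; rewrite (le_trans (ler_normD _ _))// lerD.
Qed.

Lemma bmM g h : bm g -> bm h -> bm (fun x => g x * h x).
Proof.
move=> [mg [M gM]] [mh [N hN]]; split; first exact: measurable_funM.
by exists (M * N) => x; rewrite normrM ler_pM.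
Qed.

Lemma bmN g : bm g -> bm (fun x => - g x).
Proof.
move=> [mg [M gM]]; split; first exact: measurableT_comp.
by exists M => x; rewrite normrN.
Qed.

Lemma bmB g h : bm g -> bm h -> bm (fun x => g x - h x).
Proof. by move=> bg bh; apply: bmD => //; exact: bmN. Qed.

Lemma bmZ c g : bm g -> bm (fun x => c * g x).
Proof. by apply: bmM; exact: bm_cst. Qed.

Lemma bm_sum I (r : seq I) (P : pred I) (F : I -> T -> R) :
  (forall i, bm (F i)) -> bm (fun x => \sum_(i <- r | P i) F i x).
Proof.
move=> bF; elim: r => [|i r IH].
  rewrite (_ : (fun _ => _) = fun=> 0); first exact: bm_cst.
  by apply/funext => x; rewrite big_nil.
under eq_fun do rewrite big_cons.
by case: (P i) => //; exact: bmD.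
Qed.

Lemma bm_prod I (r : seq I) (P : pred I) (F : I -> T -> R) :
  (forall i, bm (F i)) -> bm (fun x => \prod_(i <- r | P i) F i x).
Proof.
move=> bF; elim: r => [|i r IH].
  rewrite (_ : (fun _ => _) = fun=> 1); first exact: bm_cst.
  by apply/funext => x; rewrite big_nil.
under eq_fun do rewrite big_cons.
by case: (P i) => //; exact: bmM.
Qed.

Lemma bm_indic (B : set T) : measurable B -> bm (\1_B).
Proof.
move=> mB; split; first exact: measurable_indic.
by exists 1 => x; rewrite indicE; case: (_ \in _); rewrite ?normr1 ?normr0.
Qed.

Lemma bm_norm g : bm g -> bm (fun x => `|g x|).
Proof.
move=> [mg [M gM]]; split; first exact: measurableT_comp.
by exists M => x; rewrite normr_id.
Qed.

Lemma bm_integrable (mu : {finite_measure set T -> \bar R}) (D : set T) g :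
  measurable D -> bm g -> mu.-integrable D (EFin \o g).
Proof.
move=> mD [mg [M gM]]; apply: measurable_bounded_integrable => //.
- by rewrite ltey_eq fin_num_measure.
- exact: measurable_funTS.
- exists M; split; first by rewrite num_real.
  by move=> x Mx y _ /=; rewrite (le_trans (gM y))// ltW.
Qed.

End bounded_measurable.

Arguments bm_cst {d T R} c.

Lemma bm_comp d1 d2 (T1 : measurableType d1) (T2 : measurableType d2)
  (R : realType) (g : T2 -> R) (f : T1 -> T2) : measurable_fun setT f ->
  bounded_measurable g -> bounded_measurable (g \o f).
Proof.
move=> mf [mg [M gM]]; split; first exact: measurableT_comp.
by exists M => x /=.
Qed.

(* An abstract form of integration of bounded measurable functions against a
   finite signed measure. *)
Definition bounded_functional d (T : measurableType d) (R : realType)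
    (L : (T -> R) -> R) :=
  [/\ forall g h, bounded_measurable g -> bounded_measurable h ->
        L (fun x => g x + h x) = L g + L h,
      forall c g, bounded_measurable g -> L (fun x => c * g x) = c * L g &
      forall (M : R) (g_ : (T -> R)^nat) g, (forall n, bounded_measurable (g_ n)) ->
        bounded_measurable g ->
        (forall n x, `|g_ n x| <= M) -> (forall x, g_ ^~ x @ \oo --> g x) ->
        L \o g_ @ \oo --> L g].

Section bounded_functional.
Context d (T : measurableType d) (R : realType).
Implicit Types (L : (T -> R) -> R).
Local Notation bm := (@bounded_measurable d T R).

Lemma bfun0 L : bounded_functional L -> L (fun=> 0) = 0.
Proof.
by case=> _ LZ _; have /= := LZ 0 (fun=> 0) (bm_cst _); rewrite !mul0r.
Qed.

Lemma bfunB L g h : bounded_functional L -> bm g -> bm h ->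
  L (fun x => g x - h x) = L g - L h.
Proof.
case=> LD LZ _ bg bh; under eq_fun do rewrite -mulN1r.
by rewrite LD//; [rewrite LZ// mulN1r|exact: bmZ].
Qed.

Lemma bfun_sum L I (r : seq I) (P : pred I) (F : I -> T -> R) :
  bounded_functional L -> (forall i, bm (F i)) ->
  L (fun x => \sum_(i <- r | P i) F i x) = \sum_(i <- r | P i) L (F i).
Proof.
move=> bL bF; elim: r => [|i r IH].
  under eq_fun do rewrite big_nil.
  by rewrite big_nil bfun0.
under eq_fun do rewrite big_cons.
rewrite big_cons; case: (P i) => //.
by have [LD _ _] := bL; rewrite LD// ?IH//; exact: bm_sum.
Qed.

Lemma bounded_functionalB L1 L2 : bounded_functional L1 ->
  bounded_functional L2 -> bounded_functional (fun g => L1 g - L2 g).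
Proof.
move=> [D1 Z1 C1] [D2 Z2 C2]; split => [g h bg bh|c g bg|M g_ g bg_ bg gM gg].
- by rewrite D1// D2// opprD addrACA.
- by rewrite Z1// Z2// mulrBr.
- by apply: cvgB; [exact: C1 gM gg|exact: C2 gM gg].
Qed.

Lemma bounded_functional_sum I (r : seq I) (P : pred I)
  (L : I -> (T -> R) -> R) : (forall i, bounded_functional (L i)) ->
  bounded_functional (fun g => \sum_(i <- r | P i) L i g).
Proof.
move=> bL; split => [g h bg bh|c g bg|M g_ g bg_ bg gM gg].
- by rewrite -big_split; apply: eq_bigr => i _; have [->] := bL i.
- by rewrite mulr_sumr; apply: eq_bigr => i _; have [_ ->] := bL i.
- apply: cvg_big => //=; first exact: add_continuous.
  by move=> i _; have [_ _ C] := bL i; exact: C gM gg.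
Qed.

Lemma bounded_functionalM L h : bounded_functional L -> bm h ->
  bounded_functional (fun g => L (fun x => g x * h x)).
Proof.
move=> [D Z C] bh; split => [g g' bg bg'|c g bg|M g_ g bg_ bg gM gg].
- by under eq_fun do rewrite mulrDl; rewrite D//; exact: bmM.
- by under eq_fun do rewrite -mulrA; rewrite Z//; exact: bmM.
- have [mh [N hN]] := bh.
  apply: (C (M * N) (fun n x => g_ n x * h x)).
  + by move=> n; exact: bmM.
  + exact: bmM.
  + by move=> n x; rewrite normrM ler_pM.
  + by move=> x; apply: cvgMr_tmp; exact: gg.
Qed.

Lemma bounded_functional_Rintegral (mu : {finite_measure set T -> \bar R})
  (D : set T) : measurable D -> bounded_functional (Rintegral mu D).
Proof.
move=> mD; split => [g h bg bh|c g bg|M g_ g bg_ bg gM gg].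
- by rewrite RintegralD//; exact: bm_integrable.
- by rewrite RintegralZl//; exact: bm_integrable.
- apply: fine_cvg.
  rewrite fineK; last by apply: integrable_fin_num => //; exact: bm_integrable.
  apply: (@dominated_cvg _ _ _ mu D mD (fun n x => (g_ n x)%:E)
    (fun x => (g x)%:E) (fun=> M%:E)).
  + by move=> n; apply: measurableT_comp => //; apply: measurable_funTS; case: (bg_ n).
  + by move=> x _; apply: cvg_EFin; [exact: nearW|exact: gg].
  + by [].
  + by apply: (bm_integrable mu mD (bm_cst M)).
  + by move=> n x _ /=; rewrite lee_fin.
Qed.

(** Simple functions are finite combinations of indicators, and the third clause of
    [bounded_functional] passes bounded pointwise limits through [L]. Positivity of [L] is never
    invoked, so differences of integrals are covered. *)
Lemma bounded_functional_eq0 L : bounded_functional L ->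
  (forall B, measurable B -> L (\1_B) = 0) -> forall g, bm g -> L g = 0.
Proof.
move=> bL L0 g bg; have [mg [M gM]] := bg; have [LD LZ LC] := bL.
(* The shift makes the function nonnegative, as monotone approximation by simple functions requires;
   the approximants stay between 0 and [M + M]. The constant [M] is removed at the end as a multiple
   of an indicator. *)
pose h x := g x + M.
have bh : bm h by apply: bmD => //; exact: bm_cst.
have h0 x : 0 <= h x.
  by have := gM x; rewrite ler_norml => /andP[]; rewrite -subr_ge0 opprK.
have mh : measurable_fun setT (EFin \o h) by apply/measurable_EFinP; case: bh.
pose h_ n : T -> R := nnsfun_approx measurableT mh n.
have h_h x : h_ ^~ x @ \oo --> h x.
  have /fine_cvgP[_] := cvg_nnsfun_approx measurableT mh
    (fun y _ => h0 y : (0%E <= (EFin \o h) y)%E) (I : setT x).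
  exact.
have h_le n x : h_ n x <= h x.
  rewrite -(cvg_lim _ (h_h x))//; apply: nondecreasing_cvgn_le.
    by move=> a b ab; have /lefP := nd_nnsfun_approx measurableT mh ab; apply.
  by apply/cvg_ex; exists (h x).
have bh_ n : bm (h_ n).
  split; first exact: measurable_funPT.
  exists (M + M) => x; rewrite ger0_norm ?(le_trans (h_le n x))// lerD//.
  by rewrite ler_normlW.
have Lh_ n : L (h_ n) = 0.
  have fin_h : finite_set (range (h_ n)) by exact: fimfunP.
  rewrite (_ : h_ n = fun x => \sum_(y <- fset_set (range (h_ n)))
      y * \1_(h_ n @^-1` [set y]) x); last first.
    by apply/funext => x; rewrite {1}/h_ fimfunE fsbig_finite.
  have bh1 y : bm (\1_(h_ n @^-1` [set y])) by exact: bm_indic.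
  rewrite bfun_sum// => [|y]; last exact: bmZ.
  by rewrite big1// => y _; rewrite LZ// L0// mulr0.
have Lh : L h = 0.
  have := LC (M + M) h_ h bh_ bh.
  have -> : L \o h_ = fun=> 0 by apply/funext => n; exact: Lh_.
  move=> cL; have {}cL : (fun=> 0 : R) @ \oo --> L h.
    apply: cL => // n x; rewrite ger0_norm ?(le_trans (h_le n x))// lerD//.
    by rewrite ler_normlW.
  by apply: (cvg_unique _ cL); [exact: Rhausdorff|exact: cvg_cst].
have := LD g (fun=> M) bg (bm_cst M).
have -> : L (fun=> M) = 0.
  have -> : (fun=> M) = (fun x => M * \1_[set: T] x).
    by apply/funext => x; rewrite indicT mulr1.
  by rewrite LZ ?L0 ?mulr0//; exact: bm_indic.
by rewrite addr0 -/h => <-.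
Qed.

End bounded_functional.

Lemma bounded_functional_indic_eq d (T : measurableType d) (R : realType)
    (L1 L2 : (T -> R) -> R) :
  bounded_functional L1 -> bounded_functional L2 ->
  (forall B, measurable B -> L1 (\1_B) = L2 (\1_B)) ->
  forall g, bounded_measurable g -> L1 g = L2 g.
Proof.
move=> b1 b2 L12 g bg; apply/eqP; rewrite -subr_eq0; apply/eqP.
apply: (bounded_functional_eq0 (bounded_functionalB b1 b2) _ bg) => B mB.
by rewrite L12// subrr.
Qed.

Section charge.
Context d (T : measurableType d) (R : realType).
Implicit Types (nu : {charge set T -> \bar R}) (D B : set T).

Lemma bounded_functional_charge_integral nu D : measurable D ->
  bounded_functional (charge_integral nu D).
Proof.
move=> mD; apply: bounded_functionalB; exact: bounded_functional_Rintegral.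
Qed.

Lemma Rintegral_indic (mu : {finite_measure set T -> \bar R}) D B :
  measurable D -> measurable B ->
  \int[mu]_(x in D) (\1_B x) = fine (mu (B `&` D)).
Proof. by move=> mD mB; rewrite /Rintegral integral_indic. Qed.

Lemma charge_integral_indic nu D B : measurable D -> measurable B ->
  charge_integral nu D (\1_B) = fine (nu (B `&` D)).
Proof.
move=> mD mB; rewrite /charge_integral !Rintegral_indic//.
have mBD := measurableI _ _ mB mD.
rewrite (jordan_decomp (hahn_choice nu) mBD) /cadd/= cscaleN1.
by rewrite fineB// fin_num_measure.
Qed.

Lemma charge_of_densities I (r : seq I)
    (m : I -> {finite_measure set T -> \bar R}) (F : I -> T -> R) :
  (forall i, bounded_measurable (F i)) ->
  exists nu, forall B, measurable B ->
    nu B = (\sum_(i <- r) \int[m i]_(x in B) F i x)%:E.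
Proof.
move=> bF; elim: r => [|i r [nu nuE]].
  by exists czero => B _; rewrite big_nil.
have intF : (m i).-integrable setT (EFin \o F i) by exact: bm_integrable.
exists (cadd (induced_charge intF) nu) => B mB.
rewrite big_cons EFinD -nuE//= /induced_charge /Rintegral fineK//.
apply: integrable_fin_num => //; exact: bm_integrable.
Qed.

(** [charge_integral] is built from Hahn sets about which nothing explicit is known. Both sides
    being bounded functionals of [g], it is enough to compare them on indicators, where the Jordan
    parts recombine into [nu]. *)
Lemma charge_integral_densities nu D I (r : seq I)
    (m : I -> {finite_measure set T -> \bar R}) (F : I -> T -> R) :
  measurable D -> (forall i, bounded_measurable (F i)) ->
  (forall B, measurable B -> B `<=` D ->
    nu B = (\sum_(i <- r) \int[m i]_(x in B) F i x)%:E) ->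
  forall g, bounded_measurable g ->
  charge_integral nu D g = \sum_(i <- r) \int[m i]_(x in D) (g x * F i x).
Proof.
move=> mD bF nuE; apply: bounded_functional_indic_eq.
- exact: bounded_functional_charge_integral.
- apply: bounded_functional_sum => i; apply: (@bounded_functionalM _ _ _
    (Rintegral (m i) D)) => //.
  exact: bounded_functional_Rintegral.
- move=> B mB; rewrite charge_integral_indic// nuE//=; last exact: measurableI.
  apply: eq_bigr => i _; rewrite setIC Rintegral_mkcondr.
  apply: eq_Rintegral => x _; rewrite patchE indicE.
  by case: ifPn; rewrite ?mul1r ?mul0r.
Qed.

Lemma Rintegral_abs (m : {finite_measure set T -> \bar R}) (F : T -> R) B :
  measurable B -> bounded_measurable F ->
  (forall B', measurable B' -> B' `<=` B -> 0 <= \int[m]_(x in B') F x) ->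
  \int[m]_(x in B) `|F x| = \int[m]_(x in B) F x.
Proof.
move=> mB bF F0; pose neg := [set x | F x < 0].
have mneg : measurable neg.
  have [mF _] := bF; rewrite -[neg]setTI.
  have -> : neg = F @^-1` `]-oo, 0[.
    by apply/seteqP; split => x /=; rewrite in_itv.
  exact: mF.
have intF b : bounded_measurable b -> m.-integrable B (EFin \o b).
  exact: bm_integrable.
have bN := bm_norm bF.
apply/eqP; rewrite eq_le -subr_le0; apply/andP; split; last first.
  by apply: le_Rintegral => //; [exact: intF..|move=> x _; exact: ler_norm].
rewrite -RintegralB//; [|exact: intF..].
(* The difference of [|F|] and [F] is [-2 F] on [neg] and 0 elsewhere; its integral is nonpositive
   because the hypothesis makes the integral of [F] over [B] intersected with [neg] nonnegative. *)
rewrite (_ : \int[m]_(x in B) _ = \int[m]_(x in B) (- 2%:R * (F \_ neg) x)).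
  rewrite RintegralZl//; last first.
    apply: bm_integrable => //; have -> : F \_ neg = fun x => F x * \1_neg x.
      apply/funext => x; rewrite patchE indicE.
      by case: ifP; rewrite (mulr1, mulr0).
    by apply: bmM => //; exact: bm_indic.
  rewrite -Rintegral_mkcondr mulNr oppr_le0 mulr_ge0// F0//.
  exact: measurableI.
apply: eq_Rintegral => x _; rewrite patchE; case: ifPn.
  by rewrite inE /neg/= => Fx; rewrite ltr0_norm//; ring.
rewrite notin_setE /neg/= => /negP; rewrite -leNgt => Fx.
by rewrite ger0_norm// subrr; apply/esym/mulr0.
Qed.

(** The Hahn sets [P] and [N] need not be the sign sets of [F]. Measurable subsets of [P] inside [D]
    have nonnegative charge, and this already forces [F] and its absolute value to have the same
    integral over [D] intersected with [P]; likewise for [-F] on [N]. *)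
Lemma charge_tv_density nu D (m : {finite_measure set T -> \bar R})
    (F : T -> R) :
  measurable D -> bounded_measurable F ->
  (forall B, measurable B -> B `<=` D -> nu B = (\int[m]_(x in B) F x)%:E) ->
  charge_tv nu D = (\int[m]_(x in D) `|F x|%:E)%E.
Proof.
move=> mD bF nuE.
have bN := bm_norm bF.
rewrite -[RHS]fineK; last first.
  by apply: integrable_fin_num => //; exact: bm_integrable.
rewrite /charge_tv /charge_variation; move: (hahn_choice nu).
move: (projT1 _) => [P N] /= PN.
have [[mP P0] [mN N0] PNT PN0] := PN.
have mDP := measurableI _ _ mD mP; have mDN := measurableI _ _ mD mN.
rewrite jordan_posE jordan_negE cjordan_posE cjordan_negE /crestr0 !mem_set//.
rewrite /crestr !nuE// -EFinN -EFinD; congr EFin.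
rewrite -[RHS]/(\int[m]_(x in D) `|F x|).
rewrite -[in RHS](setIT D) -PNT setIUr Rintegral_setU//; last 2 first.
- exact: bm_integrable (measurableU _ _ mDP mDN) bN.
- by apply/disj_setPS; rewrite setIACA PN0 setI0.
congr (_ + _).
  rewrite Rintegral_abs// => B mB BDP; rewrite -lee_fin -nuE//.
    by apply: P0 => // x /BDP[].
  by move=> x /BDP[].
rewrite -mulN1r -RintegralZl//; last exact: bm_integrable.
under [RHS]eq_Rintegral do rewrite -normrN -mulN1r.
rewrite (Rintegral_abs (F := fun x => -1 * F x))//; first exact: bmZ.
move=> B mB BDN; rewrite RintegralZl//; last exact: bm_integrable.
rewrite mulN1r oppr_ge0 -lee_fin -nuE//.
  by apply: N0 => // x /BDN[].
by move=> x /BDN[].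
Qed.

Lemma charge_tv_bigcup nu (I : finType) (P : pred I) (E : I -> set T) :
  (forall i, P i -> measurable (E i)) -> trivIset [set` P] E ->
  charge_tv nu (\bigcup_(i in [set` P]) E i) =
  (\sum_(i | P i) charge_tv nu (E i))%E.
Proof.
move=> mE tE; rewrite /charge_tv measure_fin_bigcup//.
rewrite -(@bigfs _ _ _ _ (index_enum I))//; first exact: index_enum_uniq.
by move=> i _; rewrite mem_index_enum.
Qed.

End charge.

(** * Finite product measures on tuples *)

Section finite_pushforward.
Context d1 d2 (X : measurableType d1) (Y : measurableType d2) (R : realType).
Variables (mu : {finite_measure set X -> \bar R}) (phi : X -> Y).
Hypothesis mphi : measurable_fun setT phi.

(** The measurability proof is recorded in the term so that the measure structure, which depends on
    it, can be inferred. *)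
Definition finite_pushforward (_ : measurable_fun setT phi) : set Y -> \bar R :=
  pushforward mu phi.

Local Notation nu := (finite_pushforward mphi).

Let push := measure_function_pushforward__canonical__measure_function_Measure
  mu mphi.

Let nu0 : nu set0 = 0%E.
Proof. exact: (@measure0 _ _ _ push). Qed.

Let nu_ge0 A : (0 <= nu A)%E.
Proof. exact: (@measure_ge0 _ _ _ push). Qed.

Let nu_sigma_additive : semi_sigma_additive nu.
Proof. exact: (@measure_semi_sigma_additive _ _ _ push). Qed.

HB.instance Definition _ := isMeasure.Build _ _ _ nu
  nu0 nu_ge0 nu_sigma_additive.

Let nu_finite : fin_num_fun nu.
Proof.
move=> A mA; rewrite /finite_pushforward /pushforward fin_num_measure//.
by rewrite -[X in measurable X]setTI; exact: mphi.
Qed.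

HB.instance Definition _ := Measure_isFinite.Build _ _ _ nu nu_finite.

Lemma Rintegral_finite_pushforward (D : set Y) (f : Y -> R) :
  measurable D -> bounded_measurable f ->
  \int[nu]_(y in D) f y = \int[mu]_(x in phi @^-1` D) f (phi x).
Proof.
move=> mD bf; rewrite /Rintegral; congr fine.
apply: (integral_pushforward mphi) => //.
  by apply/measurable_EFinP; case: bf.
apply: (@bm_integrable _ _ _ mu _ (f \o phi)); last exact: bm_comp.
by rewrite -[X in measurable X]setTI; exact: mphi.
Qed.

End finite_pushforward.

Section finite_product.
Context d1 d2 (T1 : measurableType d1) (T2 : measurableType d2) (R : realType).
Variables (m1 : {finite_measure set T1 -> \bar R})
  (m2 : {finite_measure set T2 -> \bar R}).

Definition finite_product : set (T1 * T2) -> \bar R := (m1 \x m2)%E.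

HB.instance Definition _ := Measure.on finite_product.

Let fin : fin_num_fun finite_product.
Proof.
apply: lty_fin_num_fun; rewrite -setXTT [ltLHS]product_measure1E//.
by rewrite lte_mul_pinfty// ?fin_num_measure// ltey_eq fin_num_measure.
Qed.

HB.instance Definition _ := Measure_isFinite.Build _ _ _ finite_product fin.

Lemma finite_productE A B : measurable A -> measurable B ->
  finite_product (A `*` B) = (m1 A * m2 B)%E.
Proof. by move=> mA mB; exact: product_measure1E. Qed.

Variable f : T1 * T2 -> R.
Hypothesis bf : bounded_measurable f.

Let intf : (m1 \x m2)%E.-integrable setT (EFin \o f).
Proof. exact: (@bm_integrable _ _ _ finite_product). Qed.

Let bf1 x : bounded_measurable (fun y => f (x, y)).
Proof. by apply: (bm_comp (f := pair x)) bf; exact: pair1_measurable. Qed.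

Let bf2 y : bounded_measurable (fun x => f (x, y)).
Proof. by apply: (bm_comp (f := pair^~ y)) bf; exact: pair2_measurable. Qed.

Lemma Rintegral_finite_product12 :
  \int[finite_product]_z f z = \int[m1]_x \int[m2]_y f (x, y).
Proof.
rewrite /Rintegral -(integral12_prod_meas1 intf); congr fine.
apply: eq_integral => x _; rewrite /fubini_F fineK//=.
by apply: integrable_fin_num => //; apply: bm_integrable.
Qed.

Lemma Rintegral_finite_product21 :
  \int[finite_product]_z f z = \int[m2]_y \int[m1]_x f (x, y).
Proof.
rewrite /Rintegral -(integral21_prod_meas1 intf); congr fine.
apply: eq_integral => x _; rewrite /fubini_G fineK//=.
by apply: integrable_fin_num => //; apply: bm_integrable.
Qed.

Let bounded_section d (T : measurableType d) (m : {finite_measure set T -> \bar R})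
  (g : T -> R) M : bounded_measurable g -> (forall x, `|g x| <= M) ->
  `|\int[m]_x g x| <= M * fine (m setT).
Proof.
move=> bg gM; rewrite (le_trans (le_normr_Rintegral _ _))//.
  exact: bm_integrable.
rewrite -Rintegral_cst//; apply: le_Rintegral => //.
- by apply: bm_integrable => //; exact: bm_norm.
- by apply: bm_integrable => //; exact: bm_cst.
Qed.

Lemma bm_Rintegral2 : bounded_measurable (fun x => \int[m2]_y f (x, y)).
Proof.
split.
  apply/measurable_EFinP; apply: eq_measurable_fun (measurable_fubini_F intf).
  move=> x _; rewrite /fubini_F /Rintegral /= fineK//.
  by apply: integrable_fin_num => //; apply: bm_integrable.
have [_ [M fM]] := bf; exists (M * fine (m2 setT)) => x.
exact: bounded_section.
Qed.

Lemma bm_Rintegral1 : bounded_measurable (fun y => \int[m1]_x f (x, y)).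
Proof.
split.
  apply/measurable_EFinP; apply: eq_measurable_fun (measurable_fubini_G intf).
  move=> x _; rewrite /fubini_G /Rintegral /= fineK//.
  by apply: integrable_fin_num => //; apply: bm_integrable.
have [_ [M fM]] := bf; exists (M * fine (m1 setT)) => x.
exact: bounded_section.
Qed.

End finite_product.

Section product_tuple.
Context {R : realType}.
Local Notation fm := {finite_measure set (measurableTypeR R) -> \bar R}.

(** Same recursion as [lebesgue_tuple], with one factor per coordinate; finiteness gives Fubini in
    both orders for every bounded measurable function. *)
Fixpoint product_tuple n :
    ('I_n -> fm) -> {finite_measure set (euclid R n) -> \bar R} :=
  if n is m.+1 return ('I_n -> fm) -> {finite_measure set (euclid R n) -> \bar R}
  then fun mu => [the {finite_measure set (euclid R m.+1) -> \bar R} of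
    finite_pushforward
      [the {finite_measure set (measurableTypeR R * euclid R m)%type -> \bar R} of
        finite_product (mu ord0) (product_tuple (fun i => mu (lift ord0 i)))]
      (@measurable_cons_pair R m)]
  else fun=> [the {finite_measure set (euclid R 0) -> \bar R} of
               dirac ([tuple] : euclid R 0)].

Definition cons_euclid n (u : R) (t : euclid R n) : euclid R n.+1 :=
  cons_pair (u, t).

Section cons.
Variables (n : nat) (mu : 'I_n.+1 -> fm) (f : euclid R n.+1 -> R).
Hypothesis bf : bounded_measurable f.
Let mu' i := mu (lift ord0 i).

Let bfc : bounded_measurable (f \o @cons_pair R n).
Proof. by apply: bm_comp bf; exact: measurable_cons_pair. Qed.

Lemma Rintegral_product_tupleS : \int[product_tuple mu]_t f t =
  \int[mu ord0]_u \int[product_tuple mu']_t f (cons_euclid u t).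
Proof.
rewrite -(Rintegral_finite_product12 _ _ bfc).
by rewrite [LHS]Rintegral_finite_pushforward.
Qed.

Lemma Rintegral_product_tupleS' : \int[product_tuple mu]_t f t =
  \int[product_tuple mu']_t \int[mu ord0]_u f (cons_euclid u t).
Proof.
rewrite -(Rintegral_finite_product21 _ _ bfc).
by rewrite [LHS]Rintegral_finite_pushforward.
Qed.

End cons.

End product_tuple.

(** * Mixed expansion of a product integral *)

Section set_cons.
Variable n : nat.
Implicit Type A : {set 'I_n}.

(** Inductions on the dimension code a subset of ['I_n.+1] by a membership bit for [ord0] and its
    trace on the shifted coordinates. *)
Definition set_cons (b : bool) A : {set 'I_n.+1} :=
  [set i | oapp [in A] b (unlift ord0 i)].

Lemma mem_set_cons0 b A : (ord0 \in set_cons b A) = b.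
Proof. by rewrite inE unlift_none. Qed.

Lemma mem_set_consS b A i : (lift ord0 i \in set_cons b A) = (i \in A).
Proof. by rewrite inE liftK. Qed.

Lemma set_consU1 b A j : lift ord0 j |: set_cons b A = set_cons b (j |: A).
Proof.
apply/finset.setP => i; case: (unliftP ord0 i) => [k ->|->].
  by rewrite in_setU1 !mem_set_consS in_setU1 (inj_eq lift_inj).
by rewrite in_setU1 !mem_set_cons0 (negbTE (neq_lift _ _)).
Qed.

Lemma set_consU10 A : ord0 |: set_cons false A = set_cons true A.
Proof.
apply/finset.setP => i; case: (unliftP ord0 i) => [k ->|->].
  by rewrite in_setU1 !mem_set_consS eq_sym (negbTE (neq_lift _ _)).
by rewrite in_setU1 !mem_set_cons0 eqxx.
Qed.

Lemma set_cons_set0 : set_cons false finset.set0 = finset.set0.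
Proof.
apply/finset.setP => i; case: (unliftP ord0 i) => [k ->|->].
  by rewrite mem_set_consS !inE.
by rewrite mem_set_cons0 inE.
Qed.

Lemma set_cons_bij : bijective (fun p : bool * {set 'I_n} => set_cons p.1 p.2).
Proof.
exists (fun B : {set 'I_n.+1} =>
  (ord0 \in B, [set i | lift ord0 i \in B]%SET)) => [[b A]|B] /=.
  rewrite mem_set_cons0; congr pair; apply/finset.setP => i.
  by rewrite inE mem_set_consS.
apply/finset.setP => i; case: (unliftP ord0 i) => [k ->|->].
  by rewrite mem_set_consS inE.
by rewrite mem_set_cons0.
Qed.

Lemma big_set_cons (R : Type) (idx : R) (op : Monoid.com_law idx)
    (F : {set 'I_n.+1} -> R) :
  \big[op/idx]_(B : {set 'I_n.+1}) F B =
  \big[op/idx]_(b : bool) \big[op/idx]_(A : {set 'I_n}) F (set_cons b A).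
Proof.
rewrite (reindex _ (onW_bij _ set_cons_bij)).
by rewrite -(pair_bigA _ (fun b A => F (set_cons b A))).
Qed.

End set_cons.

Lemma sets0 (A : {set 'I_0}) : A = finset.set0.
Proof. by apply/finset.setP => -[]. Qed.

Section tuple_expansion.
Context {R : realType}.
Local Notation fm := {finite_measure set (measurableTypeR R) -> \bar R}.

Definition update_euclid n (t : euclid R n) (j : 'I_n) (u : R) : euclid R n :=
  [tuple if i == j then u else tnth t i | i < n].

Lemma update_cons0 n u v (t : euclid R n) :
  update_euclid (cons_euclid v t) ord0 u = cons_euclid u t.
Proof.
apply: eq_from_tnth => i; rewrite tnth_mktuple.
case: (unliftP ord0 i) => [k ->|->]; last by rewrite eqxx tnth0.
by rewrite eq_sym (negbTE (neq_lift _ _)) !tnthS.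
Qed.

Lemma update_consS n v (t : euclid R n) j u :
  update_euclid (cons_euclid v t) (lift ord0 j) u =
  cons_euclid v (update_euclid t j u).
Proof.
apply: eq_from_tnth => i; rewrite tnth_mktuple.
case: (unliftP ord0 i) => [k ->|->]; last first.
  by rewrite (negbTE (neq_lift _ _)) !tnth0.
by rewrite !tnthS tnth_mktuple (inj_eq lift_inj).
Qed.

Lemma bm_cons_euclid n (f : euclid R n.+1 -> R) :
  bounded_measurable f ->
  bounded_measurable (fun p : measurableTypeR R * euclid R n =>
    f (cons_euclid p.1 p.2)).
Proof.
move=> bf; apply: bm_comp bf; apply: eq_measurable_fun (@measurable_cons_pair _ _).
by move=> [].
Qed.

Lemma bm_cons2 n (f : euclid R n.+1 -> R) u :
  bounded_measurable f -> bounded_measurable (fun t => f (cons_euclid u t)).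
Proof.
by move=> /bm_cons_euclid/(bm_comp (f := pair u)); apply; exact: pair1_measurable.
Qed.

Lemma bm_cons1 n (f : euclid R n.+1 -> R) t :
  bounded_measurable f -> bounded_measurable (fun u => f (cons_euclid u t)).
Proof.
by move=> /bm_cons_euclid/(bm_comp (f := pair^~ t)); apply; exact: pair2_measurable.
Qed.

Lemma bm_tnth n (f : measurableTypeR R -> R) (i : 'I_n) :
  bounded_measurable f ->
  bounded_measurable (fun t : euclid R n => f (tnth t i)).
Proof. by move=> bf; apply: (bm_comp _ bf); exact: measurable_tnth. Qed.

Lemma Rintegral_swap d1 d2 (T1 : measurableType d1) (T2 : measurableType d2)
    (m1 : {finite_measure set T1 -> \bar R})
    (m2 : {finite_measure set T2 -> \bar R}) (f : T1 -> T2 -> R) :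
  bounded_measurable (fun p => f p.1 p.2) ->
  \int[m1]_x \int[m2]_y f x y = \int[m2]_y \int[m1]_x f x y.
Proof.
move=> bf; rewrite -(Rintegral_finite_product12 m1 m2 bf).
by rewrite (Rintegral_finite_product21 m1 m2 bf).
Qed.

Lemma RintegralZl_bm d (T : measurableType d)
    (m : {finite_measure set T -> \bar R}) (f : T -> R) c :
  bounded_measurable f -> \int[m]_x (c * f x) = c * \int[m]_x f x.
Proof. by move=> bf; rewrite RintegralZl//; exact: bm_integrable. Qed.

Lemma Rintegral_sum_bm d (T : measurableType d)
    (m : {finite_measure set T -> \bar R}) I (r : seq I) (P : pred I)
    (F : I -> T -> R) :
  (forall i, bounded_measurable (F i)) ->
  \int[m]_x (\sum_(i <- r | P i) F i x) = \sum_(i <- r | P i) \int[m]_x F i x.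
Proof.
by move=> bF; apply: (bfun_sum _ _ (bounded_functional_Rintegral m measurableT)).
Qed.

(* With [w = 1] and [rho j] a Dirac mass this is the fundamental theorem of
   calculus in each variable, [G A] being the mixed derivative along [A]; with
   [rho j] uniform it is its integrated version. *)
Lemma tuple_expansion n (rho : 'I_n -> fm) (m : bool -> fm)
    (w k : 'I_n -> measurableTypeR R -> R) (G : {set 'I_n} -> euclid R n -> R) :
  (forall j, bounded_measurable (w j)) ->
  (forall j, bounded_measurable (k j)) ->
  (forall A, bounded_measurable (G A)) ->
  (forall (j : 'I_n) (A : {set 'I_n}) (t : euclid R n), j \notin A ->
    \int[rho j]_u (w j u * G A (update_euclid t j u)) =
    \int[m false]_u (k j u * G A (update_euclid t j u)) +
    \int[m true]_u (k j u * G (j |: A) (update_euclid t j u))) ->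
  \int[product_tuple rho]_t ((\prod_j w j (tnth t j)) * G finset.set0 t) =
  \sum_(A : {set 'I_n}) \int[product_tuple (fun j => m (j \in A))]_t
    ((\prod_j k j (tnth t j)) * G A t).
Proof.
move=> bw bk; elim: n => [|n IH] in rho w k bw bk G * => bG H.
  rewrite (big_pred1 finset.set0); last by move=> A; rewrite [A]sets0 /= eqxx.
  by apply: eq_Rintegral => t _; rewrite !big_ord0.
pose w' j := w (lift ord0 j); pose k' j := k (lift ord0 j).
have bG' b A := bG (set_cons b A).
have bwt : bounded_measurable (fun t : euclid R n => \prod_j w' j (tnth t j)).
  by apply: bm_prod => j; apply: bm_tnth; exact: bw.
have bkt : bounded_measurable (fun t : euclid R n => \prod_j k' j (tnth t j)).
  by apply: bm_prod => j; apply: bm_tnth; exact: bk.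
have bwG : bounded_measurable (fun t => \prod_j w j (tnth t j) * G finset.set0 t).
  by apply: bmM => //; apply: bm_prod => j; exact: bm_tnth.
(* Coordinate 0 is integrated innermost, where the identity [H] applies with [A] empty. The bit [b]
   of [I b t] tells which of the two terms is meant, that is, whether 0 enters the final set. *)
rewrite Rintegral_product_tupleS'//.
pose I b t := \int[m b]_u (k ord0 u * G (set_cons b finset.set0) (cons_euclid u t)).
transitivity (\int[product_tuple (fun i => rho (lift ord0 i))]_t
    (\sum_b (\prod_j w' j (tnth t j)) * I b t)).
  apply: eq_Rintegral => t _.
  transitivity (\int[rho ord0]_u ((\prod_j w' j (tnth t j)) *
      (w ord0 u * G finset.set0 (cons_euclid u t)))).
    apply: eq_Rintegral => u _ /=; rewrite big_ord_recl tnth0 mulrAC mulrC.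
    by congr (_ * _); apply: eq_bigr => j _; rewrite tnthS.
  rewrite RintegralZl_bm; last by apply: bmM => //; exact: bm_cons1.
  rewrite -mulr_sumr big_bool /= addrC /I; congr (_ * _).
  (* The head 0 is a placeholder: [H] overwrites coordinate [ord0] with [u]. *)
  have := H ord0 finset.set0 (cons_euclid 0 t); rewrite inE => /(_ isT).
  under eq_Rintegral do rewrite update_cons0.
  under [X in _ = X + _ -> _]eq_Rintegral do rewrite update_cons0.
  under [X in _ = _ + X -> _]eq_Rintegral do rewrite update_cons0.
  by rewrite set_cons_set0 -set_consU10 set_cons_set0.
have bint b A : bounded_measurable (fun p : measurableTypeR R * euclid R n =>
    k ord0 p.1 * G (set_cons b A) (cons_euclid p.1 p.2)).
  apply: bmM; last exact: bm_cons_euclid.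
  by apply: (bm_comp (f := fst) _ (bk ord0)).
rewrite Rintegral_sum_bm => [|b]; last first.
  by apply: bmM => //; exact: (bm_Rintegral1 (m b)
    (product_tuple (fun i => rho (lift ord0 i))) (bint b finset.set0)).
rewrite big_set_cons; apply: eq_bigr => b _.
(* The order of integration is exchanged so that the induction hypothesis can be applied to the
   remaining coordinates with [u] frozen, to the family [A |-> G (set_cons b A)]. *)
transitivity (\int[m b]_u \int[product_tuple (fun i => rho (lift ord0 i))]_t
    (k ord0 u * (\prod_j w' j (tnth t j) *
      G (set_cons b finset.set0) (cons_euclid u t)))).
  rewrite [RHS]Rintegral_swap.
    apply: eq_Rintegral => t _; rewrite -RintegralZl_bm.
      by apply: eq_Rintegral => u _; rewrite mulrCA.
    by apply: bmM => //; exact: bm_cons1.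
  rewrite (_ : (fun _ => _) = (fun p : measurableTypeR R * euclid R n =>
      (\prod_j w' j (tnth p.2 j)) *
      (k ord0 p.1 * G (set_cons b finset.set0) (cons_euclid p.1 p.2)))).
    apply: bmM => //; apply: (bm_comp (f := snd) _ bwt) => //.
  by apply/funext => p; rewrite mulrCA.
transitivity (\int[m b]_u \sum_(A : {set 'I_n})
    \int[product_tuple (fun i => m (i \in A))]_t (k ord0 u *
      (\prod_j k' j (tnth t j) * G (set_cons b A) (cons_euclid u t)))).
  apply: eq_Rintegral => u _.
  rewrite RintegralZl_bm; last by apply: bmM => //; exact: bm_cons2.
  rewrite (IH _ w' k' (fun j => bw _) (fun j => bk _)
    (fun A t => G (set_cons b A) (cons_euclid u t)))//.
  - rewrite mulr_sumr; apply: eq_bigr => A _; rewrite RintegralZl_bm//.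
    by apply: bmM => //; exact: bm_cons2.
  - by move=> A; exact: bm_cons2.
  - move=> j A t jA; have := H (lift ord0 j) (set_cons b A) (cons_euclid u t).
    rewrite mem_set_consS => /(_ jA).
    under eq_Rintegral do rewrite update_consS.
    under [X in _ = X + _ -> _]eq_Rintegral do rewrite update_consS.
    under [X in _ = _ + X -> _]eq_Rintegral do rewrite update_consS.
    by rewrite set_consU1.
have bkG A : bounded_measurable (fun p : measurableTypeR R * euclid R n =>
    k ord0 p.1 * (\prod_j k' j (tnth p.2 j) *
      G (set_cons b A) (cons_euclid p.1 p.2))).
  rewrite (_ : (fun _ => _) = (fun p : measurableTypeR R * euclid R n =>
      (\prod_j k' j (tnth p.2 j)) *
      (k ord0 p.1 * G (set_cons b A) (cons_euclid p.1 p.2)))).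
    apply: bmM => //; apply: (bm_comp (f := snd) _ bkt) => //.
  by apply/funext => p; rewrite mulrCA.
rewrite Rintegral_sum_bm => [|A]; last exact: (bm_Rintegral2 (m b) _ (bkG A)).
apply: eq_bigr => A _; rewrite Rintegral_product_tupleS; last first.
  by apply: bmM => //; apply: bm_prod => j; exact: bm_tnth.
rewrite mem_set_cons0.
have -> : (fun i => m (lift ord0 i \in set_cons b A)) = (fun i => m (i \in A)).
  by apply/funext => i; rewrite mem_set_consS.
apply: eq_Rintegral => u _; apply: eq_Rintegral => t _.
rewrite big_ord_recl tnth0 -mulrA; congr (_ * (_ * _)).
by apply: eq_bigr => j _; rewrite tnthS.
Qed.

End tuple_expansion.

(** * Uniform measures on the faces of the cube *)

Section forall_sets.
Context d (T : measurableType d) (R : realType) (I : finType).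
Variable D : I -> set T.
Hypothesis mD : forall i, measurable (D i).

Lemma measurable_forall : measurable [set t | forall i, D i t].
Proof.
rewrite -[X in measurable X]setCK; apply: measurableC.
rewrite (_ : ~` _ = \bigcup_(i in setT) ~` D i); last first.
  apply/seteqP; split => t /=; first by move=> /existsNP[i Di]; exists i.
  by move=> [i _ Di]; apply/existsNP; exists i.
apply: fin_bigcup_measurable => [|i _]; last exact: measurableC.
exact: finite_finset.
Qed.

Lemma measure_forallC0 (mu : {measure set T -> \bar R}) :
  (forall i, mu (~` D i) = 0%E) -> mu (~` [set t | forall i, D i t]) = 0%E.
Proof.
move=> mu0; apply/negligibleP; first exact/measurableC/measurable_forall.
suff H (r : seq I) : mu.-negligible [set t | exists2 i, i \in r & ~ D i t].
  apply: negligibleS (H (enum I)) => t /= /existsNP[i Di].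
  by exists i; rewrite ?mem_enum.
elim: r => [|i r IH].
  apply: negligibleS (negligible_set0 mu) => t [] //.
apply: negligibleS (negligibleU _ IH); last first.
  by apply/negligibleP; [exact/measurableC/mD|exact: mu0 i].
move=> t [j]; rewrite inE => /predU1P[->|jr] Dj; first by left.
by right; exists j.
Qed.

End forall_sets.

Section face_measure.
Context {R : realType}.
Local Notation fm := {finite_measure set (measurableTypeR R) -> \bar R}.

Lemma measurable_unit : measurable (`[0%R, 1%R]%classic : set (measurableTypeR R)).
Proof. exact: measurable_itv. Qed.

Lemma lebesgue_unit_lty : (@lebesgue_measure R `[0%R, 1%R] < +oo)%E.
Proof. by rewrite lebesgue_measure_itv/= lte_fin ltr01 ltry. Qed.

Definition axis_measure (b : bool) : fm :=
  if b then [the fm of mfrestr measurable_unit lebesgue_unit_lty]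
  else [the fm of dirac (0 : measurableTypeR R)].

Lemma integral_axis_measureF (f : measurableTypeR R -> \bar R) :
  measurable_fun setT f -> (\int[axis_measure false]_u f u)%E = f (0 : R).
Proof. by move=> mf; rewrite integral_dirac// diracT mul1e. Qed.

Lemma Rintegral_axis_measureF (f : measurableTypeR R -> R) :
  measurable_fun setT f -> \int[axis_measure false]_u f u = f (0 : R).
Proof.
by move=> mf; rewrite /Rintegral integral_axis_measureF//; exact/measurable_EFinP.
Qed.

Lemma axis_measureTE A : axis_measure true A = lebesgue_measure (A `&` `[0%R, 1%R]).
Proof. by []. Qed.

Let null_out : axis_measure true (~` `[0%R, 1%R]) = 0%E.
Proof. by rewrite axis_measureTE setICl measure0. Qed.

Let axis_measure_in (f : measurableTypeR R -> \bar R) :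
  (\int[axis_measure true]_(u in `[0%R, 1%R]) f u =
   \int[lebesgue_measure]_(u in `[0%R, 1%R]) f u)%E.
Proof.
apply: eq_measure_integral => A mA A01 /=.
by rewrite /mfrestr /mrestr setIidl.
Qed.

Lemma ge0_integral_axis_measureT (f : measurableTypeR R -> \bar R) :
  measurable_fun setT f -> (forall u, 0 <= f u)%E ->
  (\int[axis_measure true]_u f u =
   \int[lebesgue_measure]_(u in `[0%R, 1%R]) f u)%E.
Proof.
move=> mf f0; rewrite (ge0_negligible_integral (measurableC measurable_unit)
  measurableT mf (fun u _ => f0 u) null_out).
by rewrite setTD setCK axis_measure_in.
Qed.

Lemma Rintegral_axis_measureT (f : measurableTypeR R -> R) :
  bounded_measurable f ->
  \int[axis_measure true]_u f u = \int[lebesgue_measure]_(u in `[0%R, 1%R]) f u.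
Proof.
move=> bf; rewrite /Rintegral (negligible_integral
  (measurableC measurable_unit) measurableT _ null_out).
  by rewrite setTD setCK axis_measure_in.
exact: bm_integrable.
Qed.

(** The slab is a measurable rectangle with a null factor: the first one, or the product of the
    others by induction. *)
Lemma product_tuple_null n (mu : 'I_n -> fm) (j : 'I_n) N :
  measurable N -> mu j N = 0%E ->
  product_tuple mu [set t | N (tnth t j)] = 0%E.
Proof.
move=> mN; elim: n => [|n IH] in mu j *; first by case: j.
case: (unliftP ord0 j) => [i ->|->] muN.
  transitivity ((mu ord0) setT *
      product_tuple (fun i => mu (lift ord0 i)) [set t | N (tnth t i)])%E.
    rewrite -finite_productE//; last first.
      by rewrite -[X in measurable X]setTI; exact: measurable_tnth.
    rewrite /= /finite_pushforward /pushforward; congr (finite_product _ _ _).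
    by apply/seteqP; split => -[u t]; rewrite /preimage/= tnthS; [|case].
  by rewrite IH// mule0.
transitivity (mu ord0 N * product_tuple (fun i => mu (lift ord0 i)) setT)%E.
  rewrite -finite_productE//.
  rewrite /= /finite_pushforward /pushforward; congr (finite_product _ _ _).
  by apply/seteqP; split => -[u t]; rewrite /preimage/= tnth0; [|case].
by rewrite muN mul0e.
Qed.

Definition face_measure n (A : {set 'I_n}) :
    {finite_measure set (euclid R n) -> \bar R} :=
  product_tuple (fun j => axis_measure (j \in A)).

(** Relative openness makes the faces disjoint, since a point determines [A] as the set of its
    nonzero coordinates; excluding the value 1 keeps them inside the half-open cube. *)
Definition open_face n (A : {set 'I_n}) : set (euclid R n) :=
  [set t | forall j, if j \in A then (0 < (tnth t j : R) < 1 : Prop)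
                     else tnth t j = 0].

Definition open_axis (b : bool) : set (measurableTypeR R) :=
  if b then `]0%R, 1%R[%classic else [set (0 : R)].

Lemma measurable_open_axis b : measurable (open_axis b).
Proof. by case: b => /=; [exact: measurable_itv|exact: measurable_set1]. Qed.

Lemma open_faceE n (A : {set 'I_n}) :
  open_face A = [set t | forall j, open_axis (j \in A) (tnth t j)].
Proof.
apply/seteqP; split => t /= tA j; have := tA j; case: (j \in A) => //=;
  by rewrite in_itv.
Qed.

Lemma axis_measure_open b : axis_measure b (~` open_axis b) = 0%E.
Proof.
case: b; last first.
  by rewrite /= /dirac indicE memNset//=; apply.
rewrite axis_measureTE /=.
rewrite (_ : _ `&` _ = [set (0 : R)] `|` [set (1 : R)]); last first.
  apply/seteqP; split => u /=; rewrite !in_itv/=.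
    move=> [/negP + /andP[u0 u1]]; rewrite negb_and -!leNgt => /orP[u0'|u1'].
      by left; apply/eqP; rewrite eq_le u0 u0'.
    by right; apply/eqP; rewrite eq_le u1 u1'.
  by case=> ->; rewrite ?ltxx ?lexx ?ler01 ?andbF.
by rewrite measureU0//; exact: lebesgue_measure_set1.
Qed.

Lemma measurable_open_face n (A : {set 'I_n}) : measurable (open_face A).
Proof.
rewrite open_faceE; apply: measurable_forall => j.
rewrite -[X in measurable X]setTI; apply: measurable_tnth => //.
exact: measurable_open_axis.
Qed.

Lemma face_measure_open n (A : {set 'I_n}) :
  face_measure A (~` open_face A) = 0%E.
Proof.
rewrite open_faceE; apply: measure_forallC0 => j.
  rewrite -[X in measurable X]setTI; apply: measurable_tnth => //.
  exact: measurable_open_axis.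
apply: (product_tuple_null (N := ~` open_axis (j \in A))).
  by apply: measurableC; exact: measurable_open_axis.
exact: axis_measure_open.
Qed.

Lemma eq_Rintegral_face n (A : {set 'I_n}) (f g : euclid R n -> R) :
  bounded_measurable f -> bounded_measurable g ->
  (forall t, open_face A t -> f t = g t) ->
  \int[face_measure A]_t f t = \int[face_measure A]_t g t.
Proof.
move=> bf bg fg; rewrite /Rintegral; congr fine.
have mC := measurableC (measurable_open_face A).
rewrite (negligible_integral mC measurableT _ (face_measure_open A)); last first.
  exact: bm_integrable.
rewrite [RHS](negligible_integral mC measurableT _ (face_measure_open A)); last first.
  exact: bm_integrable.
rewrite setTD setCK; apply: eq_integral => t; rewrite inE => At.
by rewrite fg.
Qed.

End face_measure.

Section set_cons_enum.
Variable n : nat.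
Implicit Type A : {set 'I_n}.

Lemma enum_set_cons b A :
  enum (set_cons b A) = nseq b ord0 ++ map (lift ord0) (enum A).
Proof.
rewrite {1}/enum_mem -enumT enum_ordSl /= mem_set_cons0.
have -> : [seq i <- [seq lift ord0 i | i <- enum 'I_n] | i \in set_cons b A] =
    [seq lift ord0 i | i <- enum A].
  rewrite filter_map [in RHS]/enum_mem -enumT; congr map.
  by apply: eq_filter => i; rewrite /= mem_set_consS.
by case: b.
Qed.

Lemma card_set_cons b A : #|set_cons b A| = (b + #|A|)%N.
Proof. by rewrite !cardE enum_set_cons size_cat size_nseq size_map. Qed.

Lemma set_consK (B : {set 'I_n.+1}) :
  exists b A, B = set_cons b A.
Proof.
have [f _ fK] := set_cons_bij n.
by exists (f B).1, (f B).2; rewrite fK.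
Qed.

End set_cons_enum.

Section extension.
Context {R : realType}.

(* The coordinates outside [A] vanish because [nth] returns its default value;
   this needs [size t <= #|A|]. *)
Definition extension d (A : {set 'I_d}) (t : seq R) : euclid R d :=
  [tuple nth 0 t (index j (enum A)) | j < d].

Lemma extension_set_consF d (A : {set 'I_d}) t : size t = #|A| ->
  extension (set_cons false A) t = cons_euclid 0 (extension A t).
Proof.
move=> tA; apply: eq_from_tnth => i; rewrite tnth_mktuple enum_set_cons /=.
case: (unliftP ord0 i) => [k ->|->].
  by rewrite tnthS tnth_mktuple index_map//; exact: lift_inj.
rewrite tnth0 memNindex ?size_map; last first.
  by apply/mapP => -[k _ /eqP]; rewrite (negbTE (neq_lift _ _)).
by rewrite nth_default// -cardE tA.
Qed.

Lemma extension_set_consT d (A : {set 'I_d}) u t :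
  extension (set_cons true A) (u :: t) = cons_euclid u (extension A t).
Proof.
apply: eq_from_tnth => i; rewrite tnth_mktuple enum_set_cons /=.
case: (unliftP ord0 i) => [k ->|->]; last by rewrite eqxx tnth0.
rewrite (negbTE (neq_lift _ _)) /= tnthS tnth_mktuple index_map//.
exact: lift_inj.
Qed.

Lemma measurable_extension d (A : {set 'I_d}) k :
  measurable_fun setT (fun t : euclid R k => extension A t).
Proof.
apply/measurable_fun_tnthP => j; rewrite /comp.
under eq_fun do rewrite tnth_mktuple.
have [lt_k|ge_k] := ltnP (index j (enum A)) k.
  apply: eq_measurable_fun (measurable_tnth (Ordinal lt_k)) => t _ /=.
  by rewrite (tnth_nth 0).
apply: eq_measurable_fun (measurable_cst (0 : measurableTypeR R)) => t _ /=.
by rewrite nth_default// size_tuple.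
Qed.

Definition closed_cube n : set (euclid R n) :=
  [set t | forall i, (0 <= (tnth t i : R) <= 1)%R].

Lemma measurable_closed_cube n : measurable (@closed_cube n).
Proof.
apply: (measurable_forall (D := fun j t => 0 <= (tnth t j : R) <= 1)) => j.
rewrite (_ : (fun t => _) = (fun t : euclid R n => tnth t j) @^-1` `[0%R, 1%R]).
  rewrite -[X in measurable X]setTI; apply: measurable_tnth => //.
by apply/seteqP; split => t /=; rewrite in_itv.
Qed.

Lemma ge0_integral_product_tupleS n
    (mu : 'I_n.+1 -> {finite_measure set (measurableTypeR R) -> \bar R})
    (h : euclid R n.+1 -> \bar R) :
  measurable_fun setT h -> (forall t, 0 <= h t)%E ->
  (\int[product_tuple mu]_t h t = \int[mu ord0]_u
     \int[product_tuple (fun i => mu (lift ord0 i))]_t h (cons_euclid u t))%E.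
Proof.
move=> mh h0.
have mhc : measurable_fun setT (h \o @cons_pair R n).
  by apply: measurableT_comp => //; exact: measurable_cons_pair.
rewrite [LHS](ge0_integral_pushforward (@measurable_cons_pair R n))// preimage_setT.
have h0' z : (0 <= (h \o @cons_pair R n) z)%E by exact: h0.
exact: (@fubini_tonelli1 _ _ _ _ _ (mu ord0)
  (product_tuple (fun i => mu (lift ord0 i))) _ mhc h0').
Qed.

Lemma ge0_integral_lebesgue_tupleS n (h : euclid R n.+1 -> \bar R) :
  measurable_fun setT h -> (forall t, 0 <= h t)%E ->
  (\int[@lebesgue_tuple R n.+1]_t h t = \int[lebesgue_measure]_u
     \int[@lebesgue_tuple R n]_t h (cons_euclid u t))%E.
Proof.
move=> mh h0.
have mhc : measurable_fun setT (h \o @cons_pair R n).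
  by apply: measurableT_comp => //; exact: measurable_cons_pair.
have h0' z : (0 <= (h \o @cons_pair R n) z)%E by exact: h0.
transitivity (\int[pushforward (@lebesgue_measure R \x @lebesgue_tuple R n)
    (@cons_pair R n)]_t h t)%E; first by [].
rewrite (ge0_integral_pushforward (@measurable_cons_pair R n))// preimage_setT.
exact: (@fubini_tonelli1 _ _ _ _ _ (@lebesgue_measure R)
  (@lebesgue_tuple R n) _ mhc h0').
Qed.

Lemma cons_closed_cube n u (t : euclid R n) :
  closed_cube (cons_euclid u t) <-> 0 <= u <= 1 /\ closed_cube t.
Proof.
split=> [ut|[u01 t01] i].
  split=> [|i]; first by have := ut ord0; rewrite tnth0.
  by have := ut (lift ord0 i); rewrite tnthS.
by case: (unliftP ord0 i) => [j|] ->; rewrite ?tnthS ?tnth0.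
Qed.

(** Tonelli, one coordinate at a time: a coordinate outside [A] is pinned at 0 by its Dirac factor,
    one inside [A] consumes a factor of [lebesgue_tuple]. Keeping [k] as a variable equal to [#|A|]
    lets the cardinality be rewritten without transporting tuples along equalities. *)
Lemma integral_face_measure d (A : {set 'I_d}) k (h : euclid R d -> \bar R) :
  k = #|A| -> measurable_fun setT h -> (forall t, 0 <= h t)%E ->
  (\int[@lebesgue_tuple R k]_(t in @closed_cube k) h (extension A t) =
   \int[face_measure A]_t h t)%E.
Proof.
elim: d A k h => [|d IH] B k h.
  rewrite [B]sets0 finset.cards0 => -> mh h0.
  have mD := @measurable_closed_cube 0.
  rewrite /face_measure /= !integral_dirac//; last first.
    apply: measurable_funTS; apply: measurableT_comp => //.
    exact: measurable_extension.
  by rewrite !diracE !mem_set ?mul1e//; [rewrite tuple0|case].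
have [b [A ->]] := set_consK B.
rewrite card_set_cons => kE mh h0.
have mhu u : measurable_fun setT (fun t => h (cons_euclid u t)).
  apply: measurableT_comp => //.
  exact: (measurableT_comp (@measurable_cons_pair R d) (pair1_measurable u)).
rewrite [RHS]ge0_integral_product_tupleS//.
have -> : (fun i => @axis_measure R (lift ord0 i \in set_cons b A)) =
    (fun i => axis_measure (i \in A)).
  by apply/funext => i; rewrite mem_set_consS.
rewrite -/(face_measure A).
rewrite mem_set_cons0.
have mhc : measurable_fun setT (fun p => h (@cons_pair R d p)).
  by apply: measurableT_comp => //; exact: measurable_cons_pair.
have mint : measurable_fun setT
    (fun u : measurableTypeR R => \int[face_measure A]_t h (cons_euclid u t))%E.
  have hc0 z : (0 <= (fun p => h (@cons_pair R d p)) z)%E by exact: h0.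
  exact: (@measurable_fun_fubini_tonelli_F _ _ _ _ _ (face_measure A) _ mhc hc0).
have iE u : (\int[face_measure A]_t h (cons_euclid u t) =
    \int[@lebesgue_tuple R #|A|]_(t in @closed_cube #|A|)
      h (cons_euclid u (extension A t)))%E.
  by rewrite -(IH A #|A| (fun t => h (cons_euclid u t))).
case: b kE => /= kE; last first.
  rewrite integral_axis_measureF// iE kE add0n.
  apply: eq_integral => t _; rewrite extension_set_consF//.
  by rewrite size_tuple.
rewrite kE add1n ge0_integral_axis_measureT//; last first.
  by move=> u; exact: integral_ge0.
rewrite integral_mkcond ge0_integral_lebesgue_tupleS//.
- rewrite [RHS]integral_mkcond; apply: eq_integral => u _.
  rewrite [RHS]patchE; case: ifPn => u01.
    rewrite iE [RHS]integral_mkcond; apply: eq_integral => t _.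
    rewrite !patchE extension_set_consT; congr (if _ then _ else _).
    apply/idP/idP; rewrite !inE => /=.
      by move/cons_closed_cube => [].
    by move=> ct; apply/cons_closed_cube; split => //; move: u01; rewrite inE /= in_itv.
  apply: integral0_eq => t _; rewrite patchE; case: ifPn => //.
  rewrite inE => /cons_closed_cube[u01' _]; move/negP: u01; case.
  by rewrite inE /= in_itv.
- apply/(measurable_restrictT _ _).1; first exact: measurable_closed_cube.
  apply: measurable_funTS; apply: measurableT_comp => //.
  exact: measurable_extension.
- by move=> t; rewrite patchE; case: ifP.
Qed.

End extension.

(** * Continuous functions on the unit cube *)

Section continuous_cube.
Context {R : realType} {d : nat}.
Implicit Types (g : 'rV[R]_d -> R) (t : euclid R d).

Definition row_of t : 'rV[R]_d := \row_j (tnth t j : R).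

Lemma unit_cube_row_of t : unit_cube (row_of t) <-> closed_cube t.
Proof. by split => t01 j; have := t01 j; rewrite mxE. Qed.

Lemma compact_unit_cube : compact (@unit_cube R d).
Proof.
have -> : @unit_cube R d = [set v | forall i, `[0, 1]%classic (v ord0 i)].
  by apply/seteqP; split => v /= v01 i; have := v01 i; rewrite in_itv.
by apply: (rV_compact (fun=> @segment_compact R 0 1)).
Qed.

Lemma continuous_cube_bounded g : {within unit_cube, continuous g} ->
  exists M : R, forall x, unit_cube x -> `|g x| <= M.
Proof.
move=> cg; have /compact_bounded := continuous_compact cg compact_unit_cube.
move=> [M [_ MP]]; exists (M + 1) => x x01.
by apply: (MP (M + 1) _ (g x)); [rewrite ltrDl|exists x].
Qed.

Definition grid_point k (c : {ffun 'I_d -> 'I_k.+2}) : 'rV[R]_d :=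
  \row_j ((c j)%:R / k.+1%:R).

(** The cells are closed on the left and open on the right, so the coordinate value 1 lies in the
    cell of index [k.+1]; hence [k.+2] indices. *)
Definition grid_cell k (c : {ffun 'I_d -> 'I_k.+2}) : set (euclid R d) :=
  [set t | forall j, (c j)%:R / k.+1%:R <= (tnth t j : R) < (c j).+1%:R / k.+1%:R].

Lemma measurable_grid_cell k c : measurable (@grid_cell k c).
Proof.
apply: (measurable_forall (D := fun j t =>
  (c j)%:R / k.+1%:R <= (tnth t j : R) < (c j).+1%:R / k.+1%:R)) => j.
rewrite (_ : (fun t => _) = (fun t : euclid R d => tnth t j) @^-1`
    `[((c j)%:R / k.+1%:R : R), (c j).+1%:R / k.+1%:R[).
  by rewrite -[X in measurable X]setTI; apply: measurable_tnth.
by apply/seteqP; split => t /=; rewrite in_itv.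
Qed.

Definition grid_index k t : {ffun 'I_d -> 'I_k.+2} :=
  [ffun j => inord (Num.truncn ((tnth t j : R) * k.+1%:R))].

Lemma grid_indexE k t j : closed_cube t ->
  (grid_index k t j)%:R / k.+1%:R <= (tnth t j : R) <
  (grid_index k t j).+1%:R / k.+1%:R.
Proof.
move=> t01; have /andP[t0 t1] := t01 j; rewrite ffunE.
have k0 : 0 < k.+1%:R :> R by rewrite ltr0n.
have tk0 : 0 <= (tnth t j : R) * k.+1%:R by rewrite mulr_ge0// ltW.
have /andP[le lt] := truncn_itv tk0.
rewrite inordK; last first.
  rewrite ltnS -(ler_nat R) (le_trans le)// -[leRHS]mul1r.
  by rewrite ler_wpM2r// ltW.
by rewrite ler_pdivrMr// ltr_pdivlMr// le lt.
Qed.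

Lemma grid_cell_uniq k c t : closed_cube t -> @grid_cell k c t ->
  c = grid_index k t.
Proof.
move=> t01 ct; apply/ffunP => j; apply/val_inj/eqP.
have k0 : 0 < k.+1%:R :> R by rewrite ltr0n.
have /andP[l1 u1] := ct j; have /andP[l2 u2] := grid_indexE k j t01.
have := le_lt_trans l1 u2; have := le_lt_trans l2 u1.
rewrite !ltr_pM2r ?invr_gt0// !ltr_nat !ltnS => h1 h2.
by rewrite eqn_leq h1 h2.
Qed.

(** The topology lives on row vectors and the sigma-algebra on tuples. The two are not compared: [g]
    is a pointwise limit of functions constant on grid cells, with the value at the lower corner.
    For a point of the cube this corner is again in the cube, so continuity within the cube is
    enough. *)
Lemma bm_cube g : {within unit_cube, continuous g} ->
  bounded_measurable (fun t => g (row_of t) * \1_(@closed_cube R d) t).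
Proof.
move=> cg; have [M gM] := continuous_cube_bounded cg.
pose g_ k t := (\sum_c g (@grid_point k c) * \1_(grid_cell c) t) *
  \1_(@closed_cube R d) t.
split; last first.
  exists `|M| => t; rewrite indicE; case: (boolP (t \in _)); last first.
    by rewrite mulr0 normr0.
  rewrite inE mulr1 => /unit_cube_row_of /gM h.
  by rewrite (le_trans h)// ler_norm.
have bg_ k : bounded_measurable (g_ k).
  apply: bmM; last by apply: bm_indic; exact: measurable_closed_cube.
  apply: bm_sum => c; apply: bmZ; apply: bm_indic; exact: measurable_grid_cell.
apply: (measurable_fun_cvg (h := g_) (fun k => (bg_ k).1)).
move=> t _; rewrite /g_ indicE; case: (boolP (t \in _)); last first.
  move=> _; rewrite mulr0 (_ : (fun _ => _) = fun=> 0); first exact: cvg_cst.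
  by apply/funext => k; rewrite mulr0.
rewrite inE mulr1 => t01.
have -> : (fun k => (\sum_c g (@grid_point k c) * \1_(grid_cell c) t) * true%:R) =
    (fun k => g (grid_point (grid_index k t))).
  apply/funext => k; rewrite mulr1 (bigD1 (grid_index k t))//= indicE mem_set.
    rewrite mulr1 big1 ?addr0// => c; rewrite indicE => cN.
    rewrite memNset ?mulr0// => /(grid_cell_uniq t01) cE.
    by rewrite cE eqxx in cN.
  by move=> j; exact: grid_indexE.
move/subspace_continuousP : cg => /(_ _ ((unit_cube_row_of _).2 t01)).
apply: cvg_comp => B /= WB.
have k0 k : 0 < k.+1%:R :> R by rewrite ltr0n.
have p_x : grid_point (grid_index k t) @[k --> \oo] --> row_of t.
  apply/cvg_ballP => e e0; near=> k; split=> // i j; rewrite !mxE.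
  have /andP[l u] := grid_indexE k j t01.
  rewrite /ball/= ger0_norm ?subr_ge0// (@lt_trans _ _ k.+1%:R^-1)//.
    by move: u; rewrite -addn1 natrD mulrDl mul1r ltrBlDl.
  near: k; exact: near_infty_natSinv_lt (PosNum e0).
have : \forall k \near \oo, unit_cube (grid_point (grid_index k t)) ->
    B (grid_point (grid_index k t)) by exact: p_x _ WB.
apply: filterS => k; apply => j; rewrite mxE.
have /andP[l u] := grid_indexE k j t01; have /andP[_ t1] := t01 j.
by rewrite (le_trans l)// andbT divr_ge0.
Unshelve. all: by end_near. Qed.

End continuous_cube.

(** * Calculus on the unit interval *)

Section unit_interval_calculus.
Context {R : realType}.
Local Notation leb := (@lebesgue_measure R).

Section one_sided_derivative.
Variables (phi psi : R -> R).
Hypothesis phi_psi : forall x : R, 0 <= x <= 1 ->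
  (phi u - phi x) / (u - x) @[u --> within `[0, 1] x^'] --> psi x.
Hypothesis cpsi : {within `[0, 1], continuous psi}.

(* Caratheodory's slope function: its continuity encodes differentiability. *)
Let slope x u := if u == x then psi x else (phi u - phi x) / (u - x).

Let slopeE x u : phi u - phi x = slope x u * (u - x).
Proof.
rewrite /slope; case: (eqVneq u x) => [->|ux]; first by rewrite !subrr mulr0.
by rewrite divfK// subr_eq0.
Qed.

Let cvg_slope (x : R) : 0 <= x <= 1 ->
  slope x u @[u --> within `[0, 1] (nbhs x)] --> psi x.
Proof.
move=> x01 B /= psiB.
have : \forall u \near nbhs x, u != x -> u \in `[0, 1] ->
    B ((phi u - phi x) / (u - x)) by exact: phi_psi psiB.
apply: filterS => u uB u01; rewrite /slope /preimage /=; case: (eqVneq u x) => [_|ux].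
  exact: (nbhs_singleton psiB).
exact: uB.
Qed.

Lemma one_sided_continuous : {within `[0, 1], continuous phi}.
Proof.
apply/subspace_continuousP => x; rewrite /= in_itv => x01.
have E : (fun u => phi x + slope x u * (u - x)) = phi.
  by apply/funext => u; rewrite -slopeE addrC subrK.
have : (fun u => phi x + slope x u * (u - x)) @ within `[0, 1] (nbhs x) -->
    phi x + psi x * (x - x).
  apply: cvgD; first exact: cvg_cst.
  apply: cvgM; first exact: cvg_slope.
  by apply: cvgB; [exact: cvg_within|exact: cvg_cst].
by rewrite E subrr mulr0 addr0.
Qed.

Lemma one_sided_derive (x : R) : 0 < x < 1 -> is_derive x 1 phi (psi x).
Proof.
move=> /andP[x0 x1]; apply/is_derive1_caratheodory; exists (slope x).
split=> [u||]; [exact: slopeE| |by rewrite /slope eqxx].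
have x01 : 0 <= x <= 1 by rewrite !ltW.
have sx : slope x x = psi x by rewrite /slope eqxx.
suff slope_x : slope x u @[u --> x] --> psi x by rewrite -sx in slope_x.
move=> B psiB.
have WB : \forall u \near x, u \in `[0, 1] -> B (slope x u).
  exact: cvg_slope psiB.
(* An interior point has a neighbourhood inside [0, 1], so the one-sided limit is there a full
   limit. *)
have U : \forall u \near x, u \in `]0, 1[.
  by apply: near_in_itvoo; rewrite in_itv/= x0.
suff : \forall u \near x, B (slope x u) by [].
apply: filterS2 U WB => u u01 uB; apply: uB.
by move: u01; rewrite !in_itv /= => /andP[u0 u1]; rewrite !ltW.
Qed.

Let sub01 (x : R) : 0 <= x <= 1 -> `[0, x] `<=` `[0, 1].
Proof.
by move=> /andP[_ x1] u; rewrite /= !in_itv/= => /andP[-> ux]; exact: le_trans x1.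
Qed.

Let derivable_phi (x : R) : 0 < x -> x <= 1 -> derivable_oo_LRcontinuous phi 0 x.
Proof.
move=> x0 x1; have x01 : 0 <= x <= 1 by rewrite ltW.
have /(continuous_within_itvP _ x0)[_ l r] : {within `[0, x], continuous phi}.
  exact: continuous_subspaceW (sub01 x01) one_sided_continuous.
split => // u; rewrite in_itv/= => /andP[u0 ux].
have u01 : 0 < u < 1 by rewrite u0 (lt_le_trans ux).
by have /@ex_derive := one_sided_derive u01.
Qed.

Let derive_phi (x : R) : x <= 1 -> {in `]0, x[, derive1 phi =1 psi}.
Proof.
move=> x1 u; rewrite in_itv/= => /andP[u0 ux].
have u01 : 0 < u < 1 by rewrite u0 (lt_le_trans ux).
by have := one_sided_derive u01 => ?; rewrite derive1E derive_val.
Qed.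

Lemma one_sided_FTC (x : R) : 0 <= x <= 1 ->
  phi x = phi 0 + \int[leb]_(u in `[0, x]) psi u.
Proof.
move=> x01; have /andP[x0 x1] := x01.
move: x0; rewrite le_eqVlt => /predU1P[<-|x0].
  by rewrite set_itv1 Rintegral_set1 addr0.
rewrite /Rintegral (continuous_FTC2 x0 _ (derivable_phi x0 x1) (derive_phi x1)).
  by rewrite /= addrCA subrr addr0.
exact: continuous_subspaceW (sub01 x01) cpsi.
Qed.

Lemma one_sided_FTC2 (x : R) : 0 <= x <= 1 ->
  \int[leb]_(u in `[0, x]) phi u =
  x * phi 0 + \int[leb]_(u in `[0, x]) ((x - u) * psi u).
Proof.
move=> x01; have /andP[x0 x1] := x01.
move: x0; rewrite le_eqVlt => /predU1P[<-|x0].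
  by rewrite set_itv1 !Rintegral_set1 addr0 mul0r.
have dG (u : R) : is_derive u (1 : R) (fun u : R => u - x) 1.
  by apply: is_derive_eq; rewrite /= subr0.
have cG : continuous (fun u : R => u - x).
  by move=> u; apply: cvgB; [exact: cvg_id|exact: cvg_cst].
have intE : \int[leb]_(u in `[0, x]) phi u = \int[leb]_(u in `[0, x]) (phi u * 1).
  by apply: eq_Rintegral => u _; rewrite mulr1.
(* The primitive [u - x] of the constant 1 vanishes at [x]: only the boundary term at 0 survives,
   and the kernel [x - u] appears. *)
rewrite intE (@Rintegration_by_parts R phi (fun u => u - x) psi (fun=> 1) 0 x x0).
- have -> : phi x * (x - x) - phi 0 * (0 - x) = x * phi 0 by ring.
  congr (_ + _).
  rewrite -mulN1r -RintegralZl//.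
    by apply: eq_Rintegral => u _; ring.
  apply: continuous_compact_integrable; first exact: segment_compact.
  move=> /= u; apply: (@continuousM _ _ (psi : subspace `[0, x] -> R)
    (fun u : subspace `[0, x] => (u : R) - x)).
    exact: (continuous_subspaceW (sub01 x01) cpsi).
  exact: (continuous_subspaceT cG).
- exact: continuous_subspaceW (sub01 x01) cpsi.
- exact: derivable_phi.
- exact: derive_phi.
- by apply: continuous_subspaceT => u; exact: cvg_cst.
- split => [u _||].
  + by have /@ex_derive := dG u.
  + by apply: cvg_at_right_filter; exact: cG.
  + by apply: cvg_at_left_filter; exact: cG.
- by move=> u _; rewrite derive1E; have ? := dG u; rewrite derive_val.
Qed.

End one_sided_derivative.

Definition step_kernel (x : R) : measurableTypeR R -> R := \1_(`]-oo, x]).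

(* [`|u|] in place of [u] makes the kernel bounded; only [u >= 0] matters. *)
Definition hinge_kernel (x : R) (u : measurableTypeR R) : R :=
  Num.max (x - `|u : R|) 0.

Lemma bm_step_kernel x : bounded_measurable (step_kernel x).
Proof. by apply: bm_indic; exact: measurable_itv. Qed.

Lemma bm_hinge_kernel x : bounded_measurable (hinge_kernel x).
Proof.
split.
  apply: measurable_maxr; last exact: measurable_cst.
  by apply: measurable_funB; [exact: measurable_cst|exact: normr_measurable].
exists `|x| => u.
rewrite /hinge_kernel ger0_norm; last by rewrite le_max lexx orbT.
by rewrite ge_max normr_ge0 andbT lerBlDr (le_trans (ler_norm _))// lerDl.
Qed.

Lemma step_kernel0 x : 0 <= x -> step_kernel x (0 : R) = 1.
Proof. by move=> x0; rewrite /step_kernel indicE mem_set//= in_itv. Qed.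

Lemma hinge_kernel0 x : 0 <= x -> hinge_kernel x (0 : R) = x.
Proof. by move=> x0; rewrite /hinge_kernel normr0 subr0; exact/max_idPl. Qed.

Let itvI x : 0 <= x <= 1 -> `[0, 1] `&` `]-oo, x] = `[0, x]%classic :> set R.
Proof.
move=> /andP[x0 x1]; apply/seteqP; split => u /=; rewrite !in_itv/=.
  by move=> [/andP[-> _] ->].
by move=> /andP[-> ux]; rewrite ux (le_trans ux).
Qed.

Lemma Rintegral_step_kernel x (f : measurableTypeR R -> R) :
  0 <= x <= 1 -> bounded_measurable f ->
  \int[axis_measure true]_u (step_kernel x u * f u) =
  \int[leb]_(u in `[0, x]) f u.
Proof.
move=> x01 bf; rewrite Rintegral_axis_measureT; last first.
  by apply: bmM => //; exact: bm_step_kernel.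
rewrite -(itvI x01) Rintegral_mkcondr; apply: eq_Rintegral => u _.
by rewrite patchE /step_kernel indicE; case: ifP; rewrite ?mul1r ?mul0r.
Qed.

Lemma Rintegral_hinge_kernel x (f : measurableTypeR R -> R) :
  0 <= x <= 1 -> bounded_measurable f ->
  \int[axis_measure true]_u (hinge_kernel x u * f u) =
  \int[leb]_(u in `[0, x]) ((x - u) * f u).
Proof.
move=> x01 bf; rewrite Rintegral_axis_measureT; last first.
  by apply: bmM => //; exact: bm_hinge_kernel.
rewrite -(itvI x01) Rintegral_mkcondr; apply: eq_Rintegral => u.
rewrite inE /= in_itv => /andP[u0 _].
rewrite patchE /hinge_kernel ger0_norm//; case: ifPn.
  by rewrite inE /= in_itv /= => ux; rewrite (max_idPl _)// subr_ge0.
rewrite notin_setE /= in_itv => /negP; rewrite -ltNge => ux.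
by rewrite (max_idPr _) ?mul0r// subr_le0 ltW.
Qed.

Section unit_interval_expansion.
Variables (phi psi : R -> R) (p q : measurableTypeR R -> R) (x : R).
Hypothesis phi_psi : forall x : R, 0 <= x <= 1 ->
  (phi u - phi x) / (u - x) @[u --> within `[0, 1] x^'] --> psi x.
Hypothesis cpsi : {within `[0, 1], continuous psi}.
Hypothesis x01 : 0 <= x <= 1.
Hypotheses (bp : bounded_measurable p) (bq : bounded_measurable q).
Hypothesis pE : forall u : R, 0 <= u <= 1 -> p u = phi u.
Hypothesis qE : forall u : R, 0 <= u <= 1 -> q u = psi u.

Let p0 : p (0 : R) = phi 0. Proof. by rewrite pE// lexx ler01. Qed.

Let inx (u : R) : u \in `[0, x]%classic -> 0 <= u <= 1.
Proof.
rewrite inE /= in_itv /= => /andP[-> ux]; have /andP[_ x1] := x01.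
exact: le_trans x1.
Qed.

(** The fundamental theorem of calculus in the shape of the hypothesis of [tuple_expansion], the
    left side being the evaluation at [x]. The functions [p] and [q] agree with [phi] and [psi] on
    [0, 1] only, where all the measures live. *)
Lemma step_expansion : \int[dirac (x : measurableTypeR R)]_u (1 * p u) =
  \int[axis_measure false]_u (step_kernel x u * p u) +
  \int[axis_measure true]_u (step_kernel x u * q u).
Proof.
have [mp _] := bp; have /andP[x0 x1] := x01.
rewrite Rintegral_axis_measureF; last first.
  by have [] := bmM (bm_step_kernel x) bp.
rewrite step_kernel0// mul1r Rintegral_step_kernel//.
rewrite /Rintegral integral_dirac//; last first.
  by apply/measurable_EFinP; apply: measurable_funM.
rewrite diracT mul1e mul1r /= pE// p0 (one_sided_FTC phi_psi cpsi x01).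
by congr (_ + _); apply: eq_Rintegral => u /inx u01; rewrite qE.
Qed.

(** The weight on the left is the kernel produced by [step_expansion], so that the second expansion
    starts from the integrals left by the first. *)
Lemma hinge_expansion :
  \int[axis_measure true]_u (step_kernel x u * p u) =
  \int[axis_measure false]_u (hinge_kernel x u * p u) +
  \int[axis_measure true]_u (hinge_kernel x u * q u).
Proof.
have [mp _] := bp; have /andP[x0 x1] := x01.
rewrite Rintegral_axis_measureF; last first.
  by have [] := bmM (bm_hinge_kernel x) bp.
rewrite hinge_kernel0// Rintegral_step_kernel// Rintegral_hinge_kernel// p0.
transitivity (\int[leb]_(u in `[0, x]) phi u).
  by apply: eq_Rintegral => u /inx u01; rewrite pE.
rewrite (one_sided_FTC2 phi_psi cpsi x01); congr (_ + _).
by apply: eq_Rintegral => u /inx u01; rewrite qE.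
Qed.

End unit_interval_expansion.
End unit_interval_calculus.

(** * Mixed partial derivatives *)

Lemma within_continuous_comp (U V W : topologicalType) (A : set U) (B : set V)
    (f : U -> V) (g : V -> W) :
  continuous f -> (forall x, A x -> B (f x)) ->
  {within B, continuous g} -> {within A, continuous (g \o f)}.
Proof.
move=> cf fAB /subspace_continuousP cg; apply/subspace_continuousP => x Ax C /= gC.
have WC : \forall y \near nbhs (f x), B y -> C (g y) by exact: cg (fAB _ Ax) _ gC.
have : \forall y \near nbhs x, B (f y) -> C (g (f y)) by exact: cf WC.
by apply: filterS => y h Ay; apply/h/fAB.
Qed.

Lemma row_continuous (R : realType) (T : topologicalType) d (h : 'I_d -> T -> R) :
  (forall j, continuous (h j)) ->
  continuous (fun u => \row_j h j u : 'rV[R]_d).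
Proof.
move=> ch u; apply/cvg_ballP => e e0.
have : \forall v \near u, forall j, ball (h j u) e (h j v).
  by apply: filter_forall => j; have /cvg_ballP := ch j u; exact.
apply: filterS => v hv; split=> // i j.
by rewrite !mxE.
Qed.

Section partials.
Context {R : realType} {d : nat}.
Implicit Types (f g : 'rV[R]_d -> R) (x : 'rV[R]_d) (j : 'I_d).

(** The list of [increasing_order] for an arbitrary multiplicity function: raising the order by one
    in a direction then involves no ordinal bounds. *)
Definition ordered_indices (m : 'I_d -> nat) : seq 'I_d :=
  flatten [seq nseq (m j) j | j <- enum 'I_d].

Definition nderiv (m : 'I_d -> nat) f := iter_partial (ordered_indices m) f.

Lemma count_ordered_indices m j : count_mem j (ordered_indices m) = m j.
Proof.
rewrite /ordered_indices count_flatten -map_comp sumnE big_map.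
rewrite big_enum (bigD1 j)//= big1 ?addn0.
  by rewrite count_nseq /= eqxx mul1n.
by move=> i ij; rewrite count_nseq /= (negbTE ij).
Qed.

Lemma cvg_partial k (b : {ffun 'I_d -> 'I_k}) (A : set 'rV[R]_d) f m j x :
  mderiv_exists b A f -> (forall i, (b i : nat) = (j == i) + m i)%N -> A x ->
  diff_quotient j (nderiv m f) x u @[u --> partial_filter j x] -->
    mderiv b f x.
Proof.
move=> [ex eqo] bE Ax.
have ob : deriv_order b (j :: ordered_indices m).
  by move=> i /=; rewrite count_ordered_indices bE eq_sym.
have ob' : deriv_order b (increasing_order b).
  by move=> i; exact: (count_ordered_indices (fun i => b i)).
rewrite /mderiv -(eqo _ _ ob ob' _ Ax) /=.
exact: (ex [::] j (ordered_indices m) ob x Ax).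
Qed.

Lemma update_update x j u v : update (update x j u) j v = update x j v.
Proof. by apply/rowP => i; rewrite !mxE; case: eqP. Qed.

Lemma update_id x j u : update x j u 0 j = u.
Proof. by rewrite mxE eqxx. Qed.

Lemma continuous_update x j : continuous (update x j).
Proof.
apply: row_continuous => i u; case: eqP => _; [exact: cvg_id|exact: cvg_cst].
Qed.

Lemma cvg_partial_line k (b : {ffun 'I_d -> 'I_k}) (A : set 'rV[R]_d) f m j x :
  mderiv_exists b A f -> (forall i, (b i : nat) = (j == i) + m i)%N ->
  (forall u : R, 0 <= u <= 1 -> A (update x j u)) ->
  forall v : R, 0 <= v <= 1 ->
  (nderiv m f (update x j u) - nderiv m f (update x j v)) / (u - v)
    @[u --> within `[0, 1] v^'] --> mderiv b f (update x j v).
Proof.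
move=> ex bE Ax v v01; have := cvg_partial ex bE (Ax v v01).
rewrite /diff_quotient /partial_filter update_id.
by under eq_fun do rewrite update_update.
Qed.

Lemma continuous_line (A : set 'rV[R]_d) g j x :
  {within A, continuous g} ->
  (forall u : R, 0 <= u <= 1 -> A (update x j u)) ->
  {within `[0, 1], continuous (fun u => g (update x j u))}.
Proof.
move=> cg Ax; apply: (within_continuous_comp _ _ cg).
  exact: continuous_update.
by move=> u; rewrite /= in_itv; exact: Ax.
Qed.

End partials.

Section dirac_product.
Context {R : realType}.

(** Point evaluation becomes an integral against a product measure, the form in which
    [tuple_expansion] can start from [f x]. *)
Lemma Rintegral_product_dirac n (x : 'I_n -> measurableTypeR R)
    (f : euclid R n -> R) : bounded_measurable f ->
  \int[product_tuple (fun j => dirac (x j))]_t f t =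
  f [tuple x j | j < n].
Proof.
elim: n => [|n IH] in x f * => bf.
  rewrite /Rintegral /= integral_dirac//; last by apply/measurable_EFinP; case: bf.
  by rewrite diracT mul1e /= [in LHS]tuple0 [in RHS]tuple0.
rewrite Rintegral_product_tupleS//.
transitivity (\int[dirac (x ord0)]_u
    f (cons_euclid u [tuple x (lift ord0 j) | j < n])).
  apply: eq_Rintegral => u _.
  rewrite (IH (fun j => x (lift ord0 j)) (fun t => f (cons_euclid u t)))//.
  exact: bm_cons2.
rewrite /Rintegral integral_dirac//; last first.
  by apply/measurable_EFinP; have [] := bm_cons1 [tuple x (lift ord0 j) | j < n] bf.
rewrite diracT mul1e /=; congr f; apply: eq_from_tnth => i; rewrite tnth_mktuple.
by case: (unliftP ord0 i) => [j|] ->; rewrite ?tnthS ?tnth0 ?tnth_mktuple.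
Qed.

Lemma bm_update n (f : euclid R n -> R) t j : bounded_measurable f ->
  bounded_measurable (fun u : measurableTypeR R => f (update_euclid t j u)).
Proof.
move=> bf; apply: (bm_comp _ bf); apply/measurable_fun_tnthP => i; rewrite /comp.
under eq_fun do rewrite tnth_mktuple.
by case: eqP => _; [exact: measurable_id|exact: measurable_cst].
Qed.

End dirac_product.

Section mixed_derivatives.
Context {R : realType} {d : nat}.
Variable f : 'rV[R]_d -> R.
Hypothesis smooth1 : forall a : {ffun 'I_d -> 'I_2},
  mderiv_continuous a unit_cube f.
Hypothesis smooth2 : forall a : {ffun 'I_d -> 'I_2}, nonzero a ->
  forall b : {ffun 'I_d -> 'I_3}, b \in Jset a ->
  mderiv_continuous b (face a) f.
Implicit Types (S A : {set 'I_d}) (j : 'I_d) (x : 'rV[R]_d) (t : euclid R d).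

Definition index1 S : {ffun 'I_d -> 'I_2} := [ffun j => inord (j \in S)].

(** Meant for [A] included in [S]. The empty [A] is allowed: it gives the first-order index, from
    which the second expansion starts. *)
Definition index2 S A : {ffun 'I_d -> 'I_3} :=
  [ffun j => inord ((j \in S) + (j \in A))].

Lemma index1E S j : index1 S j = (j \in S) :> nat.
Proof. by rewrite ffunE inordK// ltnS; case: (_ \in _). Qed.

Lemma index2E S A j : index2 S A j = ((j \in S) + (j \in A))%N :> nat.
Proof. by rewrite ffunE inordK//; do 2 case: (_ \in _). Qed.

Definition deriv1 S := nderiv (fun j => j \in S) f.

Definition deriv2 S A := nderiv (fun j => (j \in S) + (j \in A))%N f.

Lemma deriv1E S : deriv1 S = mderiv (index1 S) f.
Proof.
rewrite /deriv1 /nderiv; congr iter_partial; congr ordered_indices.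
by apply/funext => j; rewrite index1E.
Qed.

Lemma deriv2E S A : deriv2 S A = mderiv (index2 S A) f.
Proof.
rewrite /deriv2 /nderiv; congr iter_partial; congr ordered_indices.
by apply/funext => j; rewrite index2E.
Qed.

Lemma deriv20 S : deriv2 S finset.set0 = deriv1 S.
Proof.
rewrite /deriv2; congr nderiv; apply/funext => j.
by rewrite finset.in_set0 addn0.
Qed.

Lemma deriv1_set0 : deriv1 finset.set0 = f.
Proof.
rewrite /deriv1 /nderiv /ordered_indices.
rewrite (_ : flatten _ = [::])//; elim: (enum _) => //= j s ->.
by rewrite finset.in_set0.
Qed.

Lemma support_index1 S : support_set (index1 S) = S.
Proof. by apply/finset.setP => j; rewrite inE index1E; case: (_ \in _). Qed.

Lemma index1_support (a : {ffun 'I_d -> 'I_2}) : index1 (support_set a) = a.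
Proof.
apply/ffunP => j; apply/val_inj; rewrite /= index1E inE.
by case: (a j) => -[|[|]].
Qed.

Lemma nonzero_index1 S : nonzero (index1 S) = (S != finset.set0).
Proof.
apply/existsP/finset.set0Pn => -[j]; rewrite ?index1E => jS; exists j.
  by case: (j \in S) jS.
by rewrite index1E jS.
Qed.

Lemma max_order_index1 S : S != finset.set0 -> max_order (index1 S) = 1%N.
Proof.
move=> /finset.set0Pn[j jS]; apply/eqP; rewrite eqn_leq; apply/andP; split.
  by apply/bigmax_leqP => i _; rewrite -ltnS.
by apply: leq_trans (leq_bigmax j); rewrite index1E jS.
Qed.

Lemma max_coords_index1 S : S != finset.set0 -> max_coords (index1 S) = S.
Proof.
move=> S0; apply/finset.setP => j; rewrite inE max_order_index1// index1E.
by case: (_ \in _).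
Qed.

Lemma max_order_index2 S A : A \subset S -> A != finset.set0 ->
  max_order (index2 S A) = 2.
Proof.
move=> /fintype.subsetP AS /finset.set0Pn[j jA]; apply/eqP.
rewrite eqn_leq; apply/andP; split.
  by apply/bigmax_leqP => i _; rewrite -ltnS.
by apply: leq_trans (leq_bigmax j); rewrite index2E jA AS.
Qed.

Lemma max_coords_index2 S A : A \subset S -> A != finset.set0 ->
  max_coords (index2 S A) = A.
Proof.
move=> AS A0; apply/finset.setP => j; rewrite inE max_order_index2// index2E.
have := fintype.subsetP AS j.
by case: (j \in A) => [->//|_]; case: (_ \in _).
Qed.

Lemma index2_Jset S A : A \subset S -> A != finset.set0 ->
  index2 S A \in Jset (index1 S).
Proof.
move=> AS A0; rewrite inE max_order_index2//=; apply/forallP => j.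
rewrite support_index1 index2E; have := fintype.subsetP AS j.
by case: (j \in A) => [->//|_]; case: (_ \in _).
Qed.

Definition proj S x : 'rV[R]_d := \row_j (if j \in S then x 0 j else 0).

Lemma face_index1 S x : S != finset.set0 ->
  face (index1 S) x <->
  (forall j, if j \in S then (0 <= x 0 j <= 1 : Prop) else x 0 j = 0).
Proof. by move=> S0; rewrite /face max_coords_index1. Qed.

Lemma proj_face S x : S != finset.set0 -> unit_cube x -> face (index1 S) (proj S x).
Proof.
move=> S0 x01; apply/face_index1 => // j; rewrite mxE.
by case: (j \in S); [exact: x01|].
Qed.

Lemma continuous_proj S : continuous (proj S).
Proof.
apply: row_continuous => j; case: (j \in S) => /= x.
  exact: coord_continuous.
exact: cst_continuous.
Qed.

Lemma continuous_deriv1 S : {within unit_cube, continuous (deriv1 S)}.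
Proof. by rewrite deriv1E; case: (smooth1 (index1 S)). Qed.

(** For nonempty [A] this is smoothness assumption (ii); for empty [A] the index has maximum 1, and
    assumption (i) is restricted from the cube to the face. *)
Lemma continuous_deriv2 S A : S != finset.set0 -> A \subset S ->
  {within face (index1 S), continuous (deriv2 S A)}.
Proof.
move=> S0 AS; have [->|A0] := eqVneq A finset.set0.
  rewrite deriv20; apply: (continuous_subspaceW _ (@continuous_deriv1 S)) => x.
  move/face_index1 => /(_ S0) xS j; have := xS j; case: ifP => // _ ->.
  by rewrite lexx ler01.
rewrite deriv2E; have [|_] := smooth2 _ (index2_Jset AS A0) => //.
by rewrite nonzero_index1.
Qed.

Lemma cvg_deriv1 S j x : j \notin S ->
  (forall u : R, 0 <= u <= 1 -> unit_cube (update x j u)) ->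
  forall v : R, 0 <= v <= 1 ->
  (deriv1 S (update x j u) - deriv1 S (update x j v)) / (u - v)
    @[u --> within `[0, 1] v^'] --> deriv1 (j |: S) (update x j v).
Proof.
move=> jS; rewrite [deriv1 (j |: S)]deriv1E.
have [ex _] := smooth1 (index1 (j |: S)); apply: (cvg_partial_line ex) => i.
rewrite index1E in_setU1 eq_sym; case: eqVneq => //= <-.
by rewrite (negbTE jS).
Qed.

Lemma cvg_deriv2 S A j x : S != finset.set0 -> j |: A \subset S -> j \notin A ->
  (forall u : R, 0 <= u <= 1 -> face (index1 S) (update x j u)) ->
  forall v : R, 0 <= v <= 1 ->
  (deriv2 S A (update x j u) - deriv2 S A (update x j v)) / (u - v)
    @[u --> within `[0, 1] v^'] --> deriv2 S (j |: A) (update x j v).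
Proof.
move=> S0 jAS jA; rewrite [deriv2 S (j |: A)]deriv2E.
have jA0 : j |: A != finset.set0.
  by apply/finset.set0Pn; exists j; rewrite in_setU1 eqxx.
have nz : nonzero (index1 S) by rewrite nonzero_index1.
have [ex _] := smooth2 nz (index2_Jset jAS jA0); apply: (cvg_partial_line ex) => i.
rewrite index2E in_setU1 eq_sym; case: eqVneq => //= <-.
by rewrite (negbTE jA) addn0 addnC.
Qed.

End mixed_derivatives.

Lemma Rintegral_0 d (T : measurableType d) (R : realType)
  (m : {measure set T -> \bar R})
  (F : T -> R) : (forall x, F x = 0) -> \int[m]_x F x = 0.
Proof.
move=> F0; under eq_Rintegral do rewrite F0.
by rewrite Rintegral_cst// mul0r.
Qed.

Section expansion.
Context {R : realType} {d : nat}.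
Variable f : 'rV[R]_d -> R.
Hypothesis smooth1 : forall a : {ffun 'I_d -> 'I_2},
  mderiv_continuous a unit_cube f.
Hypothesis smooth2 : forall a : {ffun 'I_d -> 'I_2}, nonzero a ->
  forall b : {ffun 'I_d -> 'I_3}, b \in Jset a ->
  mderiv_continuous b (face a) f.
Implicit Types (S A : {set 'I_d}) (j : 'I_d) (x : 'rV[R]_d) (t : euclid R d).

Local Notation cube := (@closed_cube R d).

Definition density1 S t := deriv1 f S (row_of t) * \1_cube t.

(** The projection brings the point to the face of [S], where the derivatives are known to be
    continuous. The value 0 for [A] not included in [S] lets the expansion run over all subsets. *)
Definition density2 S A t :=
  if A \subset S then deriv2 f S A (proj S (row_of t)) * \1_cube t else 0.

Lemma bm_density1 S : bounded_measurable (density1 S).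
Proof. exact: bm_cube (continuous_deriv1 smooth1 (S := S)). Qed.

Lemma bm_density2 S A : S != finset.set0 -> bounded_measurable (density2 S A).
Proof.
move=> S0; rewrite /density2.
have [AS|_] := boolP (A \subset S); last exact: bm_cst.
apply: (bm_cube (g := fun x => deriv2 f S A (proj S x))).
have cD := continuous_deriv2 smooth1 smooth2 S0 AS.
apply: (within_continuous_comp (@continuous_proj R d S) _ cD) => x.
exact: proj_face.
Qed.

Lemma row_of_update t j u : row_of (update_euclid t j u) = update (row_of t) j u.
Proof. by apply/rowP => i; rewrite !mxE tnth_mktuple. Qed.

Lemma proj_update S x j u : j \in S ->
  proj S (update x j u) = update (proj S x) j u.
Proof.
move=> jS; apply/rowP => i; rewrite !mxE.
by have [->|_] := eqVneq i j; [rewrite jS|].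
Qed.

Lemma update_closed_cube t j v :
  cube (update_euclid t j 0) -> 0 <= v <= 1 -> cube (update_euclid t j v).
Proof.
move=> t0 v01 i; have := t0 i; rewrite !tnth_mktuple.
by case: eqP.
Qed.

Lemma update_closed_cubeN t j v :
  ~ cube (update_euclid t j 0) -> ~ cube (update_euclid t j v).
Proof.
apply: contra_not => tv i; have := tv i; rewrite !tnth_mktuple.
by case: eqP => // _ _; rewrite lexx ler01.
Qed.

Lemma expansion1 x : unit_cube x -> f x =
  \sum_S \int[face_measure S]_t
    ((\prod_j step_kernel (x 0 j) (tnth t j)) * density1 S t).
Proof.
move=> x01; pose xt : euclid R d := [tuple x 0 j | j < d].
have xtE : row_of xt = x by apply/rowP => j; rewrite mxE tnth_mktuple.
have cxt : cube xt by apply/unit_cube_row_of; rewrite xtE.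
have -> : f x = \int[product_tuple (fun j => dirac (x 0 j : measurableTypeR R))]_t
    ((\prod_(j < d) (fun=> 1) (tnth t j : R)) * density1 finset.set0 t).
  rewrite Rintegral_product_dirac; last first.
    by apply: bmM; [apply: bm_prod => j; exact: bm_cst|exact: bm_density1].
  by rewrite big1// mul1r /density1 deriv1_set0 xtE indicE mem_set// mulr1.
apply: (tuple_expansion (m := axis_measure) (w := fun _ _ => 1)
    (k := fun j => step_kernel (x 0 j))).
- by move=> j; exact: bm_cst.
- by move=> j; exact: bm_step_kernel.
- by move=> A; exact: bm_density1.
move=> j A t jA.
(* The identity is required at every [t]. Replacing coordinate [j] by 0 decides whether the line
   through [t] in direction [j] meets the cube; if it does not, all densities vanish on it. *)
have [ct|ct] := pselect (cube (update_euclid t j 0)); last first.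
  have z B u : density1 B (update_euclid t j u) = 0.
    by rewrite /density1 indicE memNset ?mulr0//; exact: update_closed_cubeN.
  by rewrite !Rintegral_0 ?addr0// => u; rewrite z mulr0.
have ux (u : R) : 0 <= u <= 1 -> unit_cube (update (row_of t) j u).
  by move=> u01; rewrite -row_of_update; apply/unit_cube_row_of/update_closed_cube.
have E B (u : R) : 0 <= u <= 1 ->
    density1 B (update_euclid t j u) = deriv1 f B (update (row_of t) j u).
  move=> u01; rewrite /density1 row_of_update indicE mem_set ?mulr1//.
  exact: update_closed_cube.
apply: (step_expansion (cvg_deriv1 smooth1 jA ux)) => //.
- by apply: (continuous_line _ ux); exact: continuous_deriv1.
- by apply: bm_update; exact: bm_density1.
- by apply: bm_update; exact: bm_density1.
- exact: E.
- exact: E.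
Qed.

(** In a direction outside [S] the variable is already pinned at 0 by a Dirac factor and nothing is
    integrated by parts, hence the factor 1. *)
Definition axis_kernel S x j : measurableTypeR R -> R :=
  if j \in S then hinge_kernel (x 0 j) else fun=> 1.

Lemma bm_axis_kernel S x j : bounded_measurable (axis_kernel S x j).
Proof.
by rewrite /axis_kernel; case: ifP => _; [exact: bm_hinge_kernel|exact: bm_cst].
Qed.

Lemma expansion2 S x : S != finset.set0 -> unit_cube x ->
  \int[face_measure S]_t
    ((\prod_j step_kernel (x 0 j) (tnth t j)) * density1 S t) =
  \sum_A \int[face_measure A]_t
    ((\prod_j axis_kernel S x j (tnth t j)) * density2 S A t).
Proof.
move=> S0 x01.
transitivity (\int[face_measure S]_t
    ((\prod_j step_kernel (x 0 j) (tnth t j)) * density2 S finset.set0 t)).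
  have bs : bounded_measurable (fun t => \prod_j step_kernel (x 0 j) (tnth t j)).
    by apply: bm_prod => j; apply: bm_tnth; exact: bm_step_kernel.
  (* [density1 f S] and the second density for the empty set need agree only where the coordinates
     outside [S] vanish, which is almost everywhere for [face_measure S]. *)
  apply: eq_Rintegral_face; [apply: bmM => //..|].
    exact: bm_density1.
    exact: bm_density2.
  move=> t St; rewrite /density2 finset.sub0set deriv20 /density1.
  congr (_ * (deriv1 f S _ * _)); apply/rowP => j; rewrite !mxE.
  by have := St j; case: (j \in S).
apply: (tuple_expansion (m := axis_measure)
    (w := fun j => step_kernel (x 0 j)) (k := axis_kernel S x)).
- by move=> j; exact: bm_step_kernel.
- exact: bm_axis_kernel.
- by move=> A; exact: bm_density2.
move=> j A t jA.
have z u : j |: A \subset S = false -> density2 S (j |: A) (update_euclid t j u) = 0.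
  by rewrite /density2 => ->.
have bd B : bounded_measurable
    (fun u : measurableTypeR R => density2 S B (update_euclid t j u)).
  by apply: bm_update; exact: bm_density2.
(* For [j] outside [S] the measure on the left is already the Dirac mass at 0 and the term of
   [j |: A] vanishes. If [A] is not included in [S], all terms vanish. The remaining case is
   integration by parts along [j]. *)
have [jS|jS] := boolP (j \in S); last first.
  have jAS : j |: A \subset S = false.
    by apply/negbTE; rewrite finset.subUset finset.sub1set (negbTE jS).
  have -> : axis_kernel S x j = fun=> 1 by rewrite /axis_kernel (negbTE jS).
  rewrite [X in _ = _ + X]Rintegral_0 ?addr0 => [|u]; last by rewrite z ?mulr0.
  rewrite !Rintegral_axis_measureF.
  - by rewrite step_kernel0//; case/andP: (x01 j).
  - by have [] := bmM (bm_cst 1) (bd A).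
  - by have [] := bmM (bm_step_kernel (x 0 j)) (bd A).
have -> : axis_kernel S x j = hinge_kernel (x 0 j) by rewrite /axis_kernel jS.
have [AS|AS] := boolP (A \subset S); last first.
  have jAS : j |: A \subset S = false.
    by apply/negbTE; rewrite finset.subUset negb_and AS orbT.
  have zA u : density2 S A (update_euclid t j u) = 0.
    by rewrite /density2 (negbTE AS).
  by rewrite !Rintegral_0 ?addr0// => u; rewrite ?zA ?z ?mulr0.
have jAS : j |: A \subset S by rewrite finset.subUset finset.sub1set jS.
have [ct|ct] := pselect (cube (update_euclid t j 0)); last first.
  have z' B u : density2 S B (update_euclid t j u) = 0.
    rewrite /density2 indicE memNset ?mulr0; last exact: update_closed_cubeN.
    by case: ifP.
  by rewrite !Rintegral_0 ?addr0// => u; rewrite z' mulr0.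
have ux (u : R) : 0 <= u <= 1 ->
    face (index1 S) (update (proj S (row_of t)) j u).
  move=> u01; rewrite -proj_update// -row_of_update; apply: proj_face => //.
  exact/unit_cube_row_of/update_closed_cube.
have E (B : {set 'I_d}) (u : R) : B \subset S -> 0 <= u <= 1 ->
    density2 S B (update_euclid t j u) =
    deriv2 f S B (update (proj S (row_of t)) j u).
  move=> BS u01; rewrite /density2 BS row_of_update proj_update//.
  by rewrite indicE mem_set ?mulr1//; exact: update_closed_cube.
apply: (hinge_expansion (cvg_deriv2 smooth2 S0 jAS jA ux)) => //.
- by apply: (continuous_line _ ux); exact: continuous_deriv2.
- by move=> u; exact: E.
- by move=> u; exact: E.
Qed.

End expansion.

(** * Existence of the representation *)

Section restriction.
Context {R : realType} {d : nat}.
Implicit Types (S A : {set 'I_d}) (t : euclid R d).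

Definition restriction S t : euclid R #|S| := [tuple tnth t (enum_val i) | i < #|S|].

Lemma measurable_restriction S : measurable_fun setT (restriction S).
Proof.
apply/measurable_fun_tnthP => i; rewrite /comp.
under eq_fun do rewrite tnth_mktuple.
exact: measurable_tnth.
Qed.

Lemma tnth_extension S (u : euclid R #|S|) j (jS : j \in S) :
  tnth (extension S u) j = tnth u (enum_rank_in jS j).
Proof.
rewrite tnth_mktuple (tnth_nth 0); congr nth.
by rewrite enum_rank_in.unlock insubdK// -topredE /= cardE index_mem mem_enum.
Qed.

Lemma tnth_extensionN S (u : euclid R #|S|) j : j \notin S ->
  tnth (extension S u) j = 0.
Proof.
move=> jS; rewrite tnth_mktuple nth_default// size_tuple cardE.
by rewrite memNindex// mem_enum.
Qed.

Lemma extensionK S t : (forall j, j \notin S -> tnth t j = 0) ->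
  extension S (restriction S t) = t.
Proof.
move=> t0; apply: eq_from_tnth => j; have [jS|jS] := boolP (j \in S).
  by rewrite (tnth_extension _ jS) tnth_mktuple enum_rankK_in.
by rewrite tnth_extensionN// t0.
Qed.

Lemma open_face_out S A t j : A \subset S -> open_face A t -> j \notin S ->
  tnth t j = 0.
Proof.
move=> AS At jS; have := At j; case: ifP => // jA.
by rewrite (fintype.subsetP AS _ jA) in jS.
Qed.

Lemma open_face_extensionK S A t : A \subset S -> open_face A t ->
  extension S (restriction S t) = t.
Proof. by move=> AS At; apply: extensionK => j; exact: open_face_out At. Qed.

Lemma measurable_half_open_cube n : measurable (@half_open_cube R n).
Proof.
apply: (measurable_forall (D := fun j (u : euclid R n) =>
  0 <= (tnth u j : R) < 1)) => j.
rewrite (_ : (fun u => _) = (fun u : euclid R n => tnth u j) @^-1` `[(0 : R), 1[).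
  by rewrite -[X in measurable X]setTI; apply: measurable_tnth.
by apply/seteqP; split => u /=; rewrite in_itv.
Qed.

Lemma open_face_half_open_cube S A t : open_face A t ->
  half_open_cube (restriction S t).
Proof.
move=> At i; rewrite tnth_mktuple; have := At (enum_val i).
by case: ifP => _; [move=> /andP[/ltW-> ->]|move=> ->; rewrite lexx ltr01].
Qed.

(** The charges live on [#|S|] coordinates, the face measures on [d]. For [A] included in [S],
    dropping the coordinates outside [S] loses nothing, since they are 0 on the face. *)
Definition face_piece S A : {finite_measure set (euclid R #|S|) -> \bar R} :=
  [the {finite_measure set (euclid R #|S|) -> \bar R} of
    finite_pushforward (face_measure A) (measurable_restriction (S := S))].

End restriction.

Lemma charge_integral_ext d (T : measurableType d) (R : realType)
    (nu : {charge set T -> \bar R}) (D : set T) (g h : T -> R) :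
  (forall x, D x -> g x = h x) -> charge_integral nu D g = charge_integral nu D h.
Proof.
by move=> gh; congr (_ - _); apply: eq_Rintegral => x; rewrite inE => /gh.
Qed.

Lemma face_measureT (R : realType) d (A : {set 'I_d}) :
  @face_measure R d A setT = 1%E.
Proof.
rewrite /face_measure; elim: d A => [|d IH] A.
  by rewrite /= diracT.
rewrite /= /finite_pushforward /pushforward preimage_setT -setXTT.
rewrite [LHS]finite_productE//.
have [b [B ->]] := set_consK A.
rewrite mem_set_cons0.
have -> : (fun i => @axis_measure R (lift ord0 i \in set_cons b B)) =
    (fun i => axis_measure (i \in B)).
  by apply/funext => i; rewrite mem_set_consS.
rewrite [X in (_ * X)%E]IH mule1; case: b; last by rewrite /= diracT.
by rewrite axis_measureTE setTI lebesgue_measure_itv /= lte_fin ltr01 oppr0 adde0.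
Qed.

Section representation.
Context {R : realType} {d : nat}.
Variable f : 'rV[R]_d -> R.
Hypothesis smooth1 : forall a : {ffun 'I_d -> 'I_2},
  mderiv_continuous a unit_cube f.
Hypothesis smooth2 : forall a : {ffun 'I_d -> 'I_2}, nonzero a ->
  forall b : {ffun 'I_d -> 'I_3}, b \in Jset a ->
  mderiv_continuous b (face a) f.
Implicit Types (S A : {set 'I_d}) (x : 'rV[R]_d) (t : euclid R d).

Definition piece_density S A (u : euclid R #|S|) : R :=
  density2 f S A (extension S u).

Lemma bm_piece_density S A : S != finset.set0 ->
  bounded_measurable (piece_density (S := S) A).
Proof.
move=> S0; apply: (bm_comp (f := fun u : euclid R #|S| => extension S u)).
  exact: measurable_extension.
exact: bm_density2.
Qed.

Lemma piece_density_out S A u : ~~ (A \subset S) -> piece_density (S := S) A u = 0.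
Proof. by rewrite /piece_density /density2 => /negbTE->. Qed.

Lemma Rintegral_face_piece S A (D : set (euclid R #|S|))
    (g : euclid R #|S| -> R) (h : euclid R d -> R) :
  bounded_measurable g -> bounded_measurable h -> measurable D ->
  (forall t, open_face A t -> D (restriction S t)) ->
  (forall t, open_face A t -> g (restriction S t) = h t) ->
  \int[face_piece S A]_(u in D) g u = \int[face_measure A]_t h t.
Proof.
move=> bg bh mD AD gh; rewrite (Rintegral_mkcond _ D).
have -> : g \_ D = (fun u => g u * \1_D u).
  apply/funext => u; rewrite patchE indicE.
  by case: ifP => _; rewrite (mulr1, mulr0).
have b1 : bounded_measurable (fun u => g u * \1_D u).
  by apply: bmM => //; exact: bm_indic.
rewrite Rintegral_finite_pushforward// preimage_setT.
apply: eq_Rintegral_face => //.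
- exact: bm_comp (measurable_restriction (S := S)) b1.
- by move=> t At; rewrite indicE mem_set ?mulr1; [exact: gh|exact: AD].
Qed.

Lemma Rintegral_piece_density S A (D : set (euclid R #|S|))
    (g : euclid R #|S| -> R) :
  S != finset.set0 -> bounded_measurable g -> measurable D ->
  (forall t, open_face A t -> D (restriction S t)) ->
  \int[face_piece S A]_(u in D) (g u * piece_density A u) =
  \int[face_measure A]_t (g (restriction S t) * density2 f S A t).
Proof.
move=> S0 bg mD AD; have bp A' := bm_piece_density A' S0.
have [AS|AS] := boolP (A \subset S); last first.
  rewrite [RHS]Rintegral_0 => [|t]; last by rewrite /density2 (negbTE AS) mulr0.
  under eq_Rintegral do rewrite piece_density_out// mulr0.
  by rewrite Rintegral_cst// mul0r.
apply: Rintegral_face_piece => //.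
- exact: bmM.
- apply: bmM; last exact: bm_density2.
  exact: bm_comp (measurable_restriction (S := S)) bg.
- by move=> t At; rewrite /piece_density (open_face_extensionK AS At).
Qed.

Definition hinge_prod S x (u : euclid R #|S|) : R :=
  \prod_(i < #|S|) hinge_kernel (x 0 (enum_val i)) (tnth u i).

Lemma bm_hinge_prod S x : bounded_measurable (hinge_prod (S := S) x).
Proof. by apply: bm_prod => i; apply: bm_tnth; exact: bm_hinge_kernel. Qed.

Lemma hinge_prodE S x (u : euclid R #|S|) : half_open_cube u ->
  hinge_prod x u =
  \prod_(i < #|S|) Num.max (x 0 (enum_val i) - (tnth u i : R)) 0.
Proof.
move=> u01; apply: eq_bigr => i _; rewrite /hinge_kernel ger0_norm//.
by case/andP: (u01 i).
Qed.

Lemma prod_axis_kernel S x t :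
  \prod_j axis_kernel S x j (tnth t j) = hinge_prod x (restriction S t).
Proof.
rewrite (bigID [in S]) /= [X in _ * X]big1 ?mulr1; last first.
  by move=> j jS; rewrite /axis_kernel (negbTE jS).
rewrite big_enum_val /=; apply: eq_bigr => i _.
by rewrite tnth_mktuple /axis_kernel enum_valP.
Qed.

(** Prescribing values only inside the half-open cube makes the property transferable, by
    uniqueness, to every representing charge. *)
Definition piece_charge S (nu : {charge set (euclid R #|S|) -> \bar R}) :=
  forall B, measurable B -> B `<=` @half_open_cube R #|S| ->
  nu B = (\sum_A \int[face_piece S A]_(u in B) piece_density A u)%:E.

Lemma piece_charge_integral S nu x : S != finset.set0 -> piece_charge (S := S) nu ->
  unit_cube x ->
  charge_integral nu (@half_open_cube R #|S|) (fun u => \prod_(i < #|S|)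
    Num.max (x 0 (enum_val i) - (tnth u i : R)) 0) =
  \int[face_measure S]_t
    ((\prod_j step_kernel (x 0 j) (tnth t j)) * density1 f S t).
Proof.
move=> S0 nuE x01; rewrite (expansion2 smooth1 smooth2 S0 x01).
rewrite (@charge_integral_ext _ _ _ nu _ _ (hinge_prod x)); last first.
  by move=> u /hinge_prodE ->.
rewrite (charge_integral_densities (@measurable_half_open_cube R _)
  (fun A => bm_piece_density A S0) nuE (bm_hinge_prod S x)).
apply: eq_bigr => A _; rewrite Rintegral_piece_density//.
- by apply: eq_Rintegral => t _; rewrite prod_axis_kernel.
- exact: bm_hinge_prod.
- exact: measurable_half_open_cube.
- exact: open_face_half_open_cube.
Qed.

Definition piece_family (nu : @charge_family R d) :=
  forall a, nonzero a -> piece_charge (nu a).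

Lemma piece_family_exists : exists nu, piece_family nu.
Proof.
have H (a : {ffun 'I_d -> 'I_2}) :
    {nu : {charge set (euclid R #|support_set a|) -> \bar R} |
      nonzero a -> piece_charge nu}.
  apply/cid; have [nz|nz] := boolP (nonzero a); last by exists czero.
  have S0 : support_set a != finset.set0.
    by rewrite -nonzero_index1 index1_support.
  have [nu nuE] := charge_of_densities (index_enum {set 'I_d})
    (face_piece (support_set a)) (fun A => bm_piece_density A S0).
  by exists nu => _ B mB _; exact: nuE.
by exists (fun a => projT1 (H a)) => a; exact: projT2 (H a).
Qed.

Lemma big_support_set (V : Type) (idx : V) (op : Monoid.com_law idx)
    (P : pred {set 'I_d}) (F : {set 'I_d} -> V) :
  \big[op/idx]_(S | P S) F S =
  \big[op/idx]_(a : {ffun 'I_d -> 'I_2} | P (support_set a)) F (support_set a).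
Proof.
apply: reindex; apply: onW_bij; exists index1.
  exact: index1_support.
exact: support_index1.
Qed.

Lemma nonzero_support (a : {ffun 'I_d -> 'I_2}) :
  nonzero a = (support_set a != finset.set0).
Proof. by rewrite -nonzero_index1 index1_support. Qed.

(** In the first expansion the empty set contributes [f 0], and the terms with more than [s]
    elements vanish because their density is the mixed derivative assumed to be 0. The same family
    thus serves for every [s]. *)
Lemma piece_family_represents s nu : piece_family nu ->
  (forall a : {ffun 'I_d -> 'I_2}, (s < #|support_set a|)%N ->
    forall x, unit_cube x -> mderiv a f x = 0) ->
  mars_represents s f (f 0) nu.
Proof.
move=> nuE f0 x x01; rewrite (expansion1 smooth1 x01) /mars_fun.
rewrite (bigD1 finset.set0)//=; congr (_ + _).
  rewrite (@eq_Rintegral_face _ _ _ _ (fun=> f 0)).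
  - rewrite Rintegral_cst// [X in _ * fine X]face_measureT mulr1//.
  - apply: bmM; last exact: bm_density1.
    by apply: bm_prod => j; apply: bm_tnth; exact: bm_step_kernel.
  - exact: bm_cst.
  - move=> t At; have t0 j : tnth t j = 0.
      by have := At j; rewrite finset.in_set0.
    rewrite big1 ?mul1r => [|j _]; last first.
      by rewrite t0 step_kernel0//; case/andP: (x01 j).
    rewrite /density1 deriv1_set0 indicE mem_set ?mulr1; last first.
      by move=> j; rewrite t0 lexx ler01.
    by congr f; apply/rowP => j; rewrite !mxE t0.
rewrite big_support_set.
rewrite (bigID (fun a => #|support_set a| <= s)%N) /= [X in _ + X]big1 ?addr0.
  apply: eq_big => a; first by rewrite nonzero_support.
  move=> /andP[nz _]; rewrite piece_charge_integral//.
  by apply: nuE; rewrite nonzero_support.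
move=> a /andP[_]; rewrite -ltnNge => sa.
apply: Rintegral_0 => t; rewrite /density1 indicE.
case: (boolP (t \in _)); last by rewrite !mulr0.
rewrite inE => /unit_cube_row_of ct.
by rewrite deriv1E index1_support f0// !(mul0r, mulr0).
Qed.

End representation.

(** * Uniqueness of the representation *)

Section hinge_uniqueness.
Context {R : realType} {n : nat}.
Implicit Types (u : euclid R n).
Local Notation cube := (@half_open_cube R n).

(** The left derivative of [hinge_kernel c v] in [c], for [c] nonnegative; on nonnegative [v] it is
    the indicator of [[0, c[]. *)
Definition ball_kernel (c : R) (v : measurableTypeR R) : R :=
  \1_[set w : measurableTypeR R | `|w : R| < c] v.

Lemma bm_ball_kernel (c : R) : bounded_measurable (ball_kernel c).
Proof.
apply: bm_indic; rewrite (_ : [set _ | _] = `]- c, c[%classic).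
  exact: measurable_itv.
by apply/seteqP; split => w /=; rewrite in_itv /= ltr_norml.
Qed.

(** A difference quotient taken to the left with step [1 / (m + 1)]; clamping the left point at 0
    keeps it in [0, 1], the range covered by [L_hinge]. *)
Definition hinge_slope (c : R) (m : nat) (v : measurableTypeR R) : R :=
  m.+1%:R * (hinge_kernel c v - hinge_kernel (Num.max (c - m.+1%:R^-1) 0) v).

(** The hinge is 1-Lipschitz in [c], and clamping only shortens the step. This is the uniform bound
    needed for bounded convergence. *)
Lemma hinge_slope_le1 (c : R) m v : 0 <= c -> `|hinge_slope c m v| <= 1.
Proof.
move=> c0; rewrite /hinge_slope normrM ger0_norm// mulrC -ler_pdivlMr ?ltr0n// div1r.
have m0 : 0 <= m.+1%:R^-1 :> R by rewrite invr_ge0.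
rewrite /hinge_kernel; have v0 := normr_ge0 (v : R).
move: (`|v : R|) (m.+1%:R^-1) v0 m0 => w e w0 e0.
rewrite ler_norml; rewrite /Num.max.
by do ?case: ifPn; rewrite -?leNgt => *; apply/andP; split; lra.
Qed.

Lemma hinge_slope_cvg (c : R) v : 0 <= c ->
  hinge_slope c m v @[m --> \oo] --> ball_kernel c v.
Proof.
move=> c0; rewrite /ball_kernel indicE.
have [vc|vc] := boolP (v \in _).
  move: vc; rewrite inE /= => vc.
  have cv : 0 < c - `|v : R| by rewrite subr_gt0.
  apply: cvg_near_cst; near=> m.
  have mcv : m.+1%:R^-1 < c - `|v : R|.
    by near: m; exact: near_infty_natSinv_lt (PosNum cv).
  have v0 := normr_ge0 (v : R).
  rewrite /hinge_slope /hinge_kernel.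
  have m0 : 0 <= m.+1%:R^-1 :> R by rewrite invr_ge0.
  have me : m.+1%:R * m.+1%:R^-1 = 1 :> R by rewrite divff.
  move: (`|v : R|) (m.+1%:R^-1) v0 m0 me mcv => w e w0 e0 me mcw.
  have -> : Num.max (c - e) 0 = c - e by apply: max_l; clear -mcw w0; lra.
  have -> : Num.max (c - w) 0 = c - w by apply: max_l; clear -mcw e0; lra.
  have -> : Num.max (c - e - w) 0 = c - e - w by apply: max_l; clear -mcw; lra.
  by rewrite -[RHS]me; congr (_ * _); ring.
move: vc; rewrite notin_setE /= => /negP; rewrite -leNgt => vc.
apply: cvg_near_cst; near=> m; rewrite /hinge_slope /hinge_kernel.
have m0 : 0 <= m.+1%:R^-1 :> R by rewrite invr_ge0.
have v0 := normr_ge0 (v : R).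
move: (`|v : R|) (m.+1%:R^-1) v0 m0 vc => w e w0 e0 cw.
have -> : Num.max (c - w) 0 = 0 by apply: max_r; lra.
have -> : Num.max (Num.max (c - e) 0 - w) 0 = 0.
  by apply: max_r; rewrite subr_le0 ge_max w0 andbT; lra.
by rewrite subrr mulr0.
Unshelve. all: by end_near. Qed.

Variable L : (euclid R n -> R) -> R.
Hypothesis bL : bounded_functional L.
Hypothesis L_cube : forall g h, bounded_measurable g -> bounded_measurable h ->
  (forall u, cube u -> g u = h u) -> L g = L h.
Hypothesis L_hinge : forall c : 'I_n -> R, (forall i, 0 <= c i <= 1) ->
  L (fun u => \prod_i hinge_kernel (c i) (tnth u i)) = 0.

(** The state after the first [k] coordinates have been differentiated: [k = 0] is [L_hinge], and
    [k = n] involves indicators only. *)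
Let kernel k (i : 'I_n) := if (i < k)%N then ball_kernel else hinge_kernel.

Let bm_kernel k i a : bounded_measurable (kernel k i a).
Proof.
by rewrite /kernel; case: ifP => _; [exact: bm_ball_kernel|exact: bm_hinge_kernel].
Qed.

Let L_mixed k (c : 'I_n -> R) : (forall i, 0 <= c i <= 1) ->
  L (fun u => \prod_i kernel k i (c i) (tnth u i)) = 0.
Proof.
elim: k c => [|k IH] c c01.
  exact: L_hinge.
have [nk|kn] := leqP n k.
  rewrite -[RHS](IH c c01); congr L; apply/funext => u; apply: eq_bigr => i _.
  have ik := leq_trans (ltn_ord i) nk.
  by rewrite /kernel ik ltnS (ltnW ik).
pose i0 := Ordinal kn.
pose rest u := \prod_(i < n | i != i0) kernel k i (c i) (tnth u i).
have brest : bounded_measurable rest.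
  by apply: bm_prod => i; apply: bm_tnth; exact: bm_kernel.
have c0 : 0 <= c i0 by case/andP: (c01 i0).
have IH' a : 0 <= a <= 1 -> L (fun u => hinge_kernel a (tnth u i0) * rest u) = 0.
  move=> a01; have := IH (fun i => if i == i0 then a else c i).
  rewrite (_ : (fun u => _) = (fun u => hinge_kernel a (tnth u i0) * rest u)).
    by apply=> i; case: ifP.
  apply/funext => u; rewrite (bigD1 i0)//= eqxx /kernel ltnn; congr (_ * _).
  by apply: eq_bigr => i /negbTE ->.
have bh a : bounded_measurable (fun u : euclid R n => hinge_kernel a (tnth u i0)).
  by apply: bm_tnth; exact: bm_hinge_kernel.
have bhs m : bounded_measurable
    (fun u : euclid R n => hinge_slope (c i0) m (tnth u i0)).
  by apply: bmZ; exact: bmB.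
have bb : bounded_measurable (fun u : euclid R n => ball_kernel (c i0) (tnth u i0)).
  by apply: bm_tnth; exact: bm_ball_kernel.
have [LD LZ LC] := bL; have [_ [M restM]] := brest.
have cv : L (fun u => hinge_slope (c i0) m (tnth u i0) * rest u) @[m --> \oo] -->
    L (fun u => ball_kernel (c i0) (tnth u i0) * rest u).
  apply: (LC (1 * M) (fun m u => hinge_slope (c i0) m (tnth u i0) * rest u)).
  - by move=> m; exact: bmM.
  - exact: bmM.
  - by move=> m u; rewrite normrM ler_pM// hinge_slope_le1.
  - by move=> u; apply: cvgMr_tmp; exact: hinge_slope_cvg.
rewrite (_ : (fun u => _) =
    (fun u => ball_kernel (c i0) (tnth u i0) * rest u)); last first.
  apply/funext => u; rewrite (bigD1 i0)//= {1}/kernel ltnSn; congr (_ * _).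
  apply: eq_bigr => i ii0; rewrite /kernel ltnS leq_eqVlt.
  suff -> : (i == k :> nat) = false by [].
  by apply/negbTE; move: ii0; apply: contra => /eqP ik; apply/eqP/val_inj.
(* Each quotient is a multiple of a difference of two products on which [L] vanishes by induction,
   so the sequence is constantly 0 and so is its limit. *)
rewrite -(cvg_lim _ cv)//; apply: lim_near_cst => //; near=> m.
rewrite (_ : (fun u => _) = (fun u => m.+1%:R *
    (hinge_kernel (c i0) (tnth u i0) * rest u -
     hinge_kernel (Num.max (c i0 - m.+1%:R^-1) 0) (tnth u i0) * rest u)));
  last first.
  by apply/funext => u; rewrite /hinge_slope; ring.
rewrite LZ; last by apply: bmB; exact: bmM.
rewrite bfunB//; [|exact: bmM..].
rewrite !IH' ?subrr ?mulr0//.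
rewrite le_max lexx orbT /= ge_max ler01 andbT.
by case/andP: (c01 i0) => _; apply: le_trans; rewrite gerBl invr_ge0.
Unshelve. all: by end_near. Qed.

Definition orthant (c : 'I_n -> R) : set (euclid R n) :=
  [set u | forall i, (tnth u i : R) < c i].

Let measurable_orthant c : measurable (orthant c).
Proof.
apply: (measurable_forall (D := fun i (u : euclid R n) => (tnth u i : R) < c i)) => i.
rewrite (_ : (fun u => _) = (fun u : euclid R n => tnth u i) @^-1` `]-oo, c i[).
  by rewrite -[X in measurable X]setTI; apply: measurable_tnth.
by apply/seteqP; split => u /=; rewrite in_itv.
Qed.

Let L_orthant c : L (\1_(orthant c)) = 0.
Proof.
(* [L_mixed] covers bounds in [0, 1] only. On the half-open cube clamping does not affect the
   comparison with [c i], and by [L_cube] only values there matter. *)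
pose c' i := Num.min (Num.max (c i) 0) 1.
have c'01 i : 0 <= c' i <= 1.
  by rewrite /c' le_min ge_min le_max !lexx ler01 !orbT.
rewrite -(L_mixed n c'01); apply: L_cube.
- exact: bm_indic.
- by apply: bm_prod => i; apply: bm_tnth; exact: bm_kernel.
move=> u cu.
have E i : kernel n i (c' i) (tnth u i) = ((tnth u i : R) < c i)%R%:R.
  rewrite /kernel ltn_ord /ball_kernel indicE; congr (_%:R); congr nat_of_bool.
  have /andP[u0 u1] := cu i.
  apply/idP/idP; rewrite inE /= ger0_norm// /c' lt_min u1 andbT lt_max.
    by case/orP => //; rewrite ltNge u0.
  by move=> ->.
under eq_bigr do rewrite E.
rewrite indicE; case: (boolP (u \in _)).
  by rewrite inE => uc; rewrite big1// => i _; rewrite uc.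
rewrite notin_setE /orthant /= => /existsNP[i /negP/negbTE ui].
by rewrite (bigD1 i)//= ui mul0r.
Qed.

Let null B := measurable B /\ L (\1_B) = 0.

(** Proper differences follow from linearity. The whole space and increasing unions are bounded
    pointwise limits of indicators, the whole space being exhausted by the orthants with all bounds
    equal to [m]. *)
Let lambda_null : lambda_system setT null.
Proof.
have [LD LZ LC] := bL.
have lim0 (F : (set (euclid R n))^nat) (B : set (euclid R n)) :
    (forall m, null (F m)) -> measurable B ->
    (forall u, \1_(F m) u @[m --> \oo] --> (\1_B u : R)) -> null B.
  move=> F0 mB FB; split=> //.
  have cv : L (\1_(F m)) @[m --> \oo] --> L (\1_B).
    apply: (LC 1 (fun m => \1_(F m))) => //.
    - by move=> m; apply: bm_indic; case: (F0 m).
    - exact: bm_indic.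
    - by move=> m u; rewrite indicE; case: (_ \in _); rewrite ?normr1 ?normr0.
  rewrite -(cvg_lim _ cv)//; apply: lim_near_cst => //; near=> m.
  by case: (F0 m).
split=> //.
- apply: (lim0 (fun m => orthant (fun=> m%:R))) => // u.
  rewrite indicT; apply: cvg_near_cst.
  have : \forall m \near \oo, forall i, (tnth u i : R) < m%:R.
    by apply: filter_forall => i; exact: nbhs_infty_gtr.
  by apply: filterS => m um; rewrite indicE mem_set.
- move=> A B BA [mA LA] [mB LB]; split; first exact: measurableD.
  have -> : \1_(A `\` B) = (fun u => \1_A u - \1_B u) :> (_ -> R).
    apply/funext => u; rewrite !indicE in_setD.
    have [uB|uB] := boolP (u \in B).
      by rewrite andbF (mem_set (BA _ (set_mem uB))) subrr.
    by rewrite andbT subr0.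
  by rewrite bfunB ?LA ?LB ?subrr//; exact: bm_indic.
- move=> F ndF F0; apply: (lim0 F) => //.
    by apply: bigcupT_measurable => m; case: (F0 m).
  move=> u; apply: cvg_near_cst; rewrite (indicE R (\bigcup_k F k) u).
  have [|uN] := boolP (u \in _).
    rewrite inE => -[m _ Fm]; near=> k; rewrite indicE mem_set//.
    have /subsetPset : (F m <= F k)%O by apply: ndF; near: k; exact: nbhs_infty_ge.
    exact.
  near=> k; rewrite indicE memNset// => Fk.
  by move: uN; rewrite notin_setE; apply; exists k.
Unshelve. all: by end_near. Qed.

Lemma bounded_functional_hinge0 g : bounded_measurable g -> L g = 0.
Proof.
apply: bounded_functional_eq0 => // B mB.
pose G := [set B | exists c, B = orthant c].
have GI : setI_closed G.
  move=> _ _ [c ->] [c' ->]; exists (fun i => Num.min (c i) (c' i)).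
  apply/seteqP; split => u /=.
    by move=> [uc uc'] i; rewrite lt_min uc uc'.
  by move=> uc; split => i; have := uc i; rewrite lt_min => /andP[].
have Gnull : G `<=` null by move=> _ [c ->]; split.
suff [_ ->] : null B by [].
apply: (lambda_system_subset GI lambda_null Gnull) => //.
(* Orthants generate the product sigma-algebra: the half-space where coordinate [i] is below [a] is
   the union over [k] of the orthants with bound [a] in direction [i] and [k] in the others. *)
have mid : measurable_fun setT (id : g_sigma_algebraType G -> euclid R n).
  apply/measurable_fun_tnthP => i.
  apply: (measurability _ (RGenInftyO.measurableE R)) => _ [_ [a ->] <-].
  rewrite setTI (_ : _ @^-1` _ =
      \bigcup_k orthant (fun j => if j == i then a else k%:R)).
    apply: bigcupT_measurable => k; apply: sub_sigma_algebra.
    by exists (fun j => if j == i then a else k%:R).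
  apply/seteqP; split => u /=; rewrite in_itv /=.
    move=> ua; have [k _ kP] : \forall m \near \oo, forall j, (tnth u j : R) < m%:R.
      by apply: filter_forall => j; exact: nbhs_infty_gtr.
    exists k => // j; case: eqP => [->//|_].
    exact: (kP k (leqnn k)).
  by move=> [k _ /(_ i)]; rewrite eqxx.
by have := mid measurableT B mB; rewrite setTI.
Qed.

End hinge_uniqueness.

Section charge_family_uniqueness.
Context {R : realType} {d : nat}.
Implicit Types (nu : @charge_family R d) (x : 'rV[R]_d)
  (a : {ffun 'I_d -> 'I_2}).

Definition family_term nu a x : R :=
  charge_integral (nu a) (@half_open_cube R #|support_set a|)
    (fun t => \prod_(i < #|support_set a|)
       Num.max (x 0 (enum_val i) - (tnth t i : R)) 0).

Lemma family_term_proj nu a x :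
  family_term nu a (proj (support_set a) x) = family_term nu a x.
Proof.
apply: charge_integral_ext => u _; apply: eq_bigr => i _.
by rewrite mxE enum_valP.
Qed.

(** The factor [max (0 - t_j) 0] vanishes for every [t] in the cube. *)
Lemma family_term0 nu a x j : j \in support_set a -> x 0 j = 0 ->
  family_term nu a x = 0.
Proof.
move=> ja xj; rewrite /family_term.
rewrite (@charge_integral_ext _ _ _ (nu a) _ _ (fun=> 0)).
  apply: bfun0; apply: bounded_functional_charge_integral.
  exact: measurable_half_open_cube.
move=> u cu; rewrite (bigD1 (enum_rank_in ja j))//= enum_rankK_in//.
rewrite xj max_r ?mul0r// sub0r oppr_le0.
by case/andP: (cu (enum_rank_in ja j)).
Qed.

Lemma family_term_eq s f c1 nu1 c2 nu2 a x :
  mars_represents s f c1 nu1 -> mars_represents s f c2 nu2 ->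
  nonzero a -> (#|support_set a| <= s)%N -> unit_cube x ->
  family_term nu1 a x = family_term nu2 a x.
Proof.
move=> rep1 rep2.
have sumE y : unit_cube y ->
    c1 + \sum_(b : {ffun 'I_d -> 'I_2} | nonzero b && (#|support_set b| <= s)%N)
      family_term nu1 b y =
    c2 + \sum_(b : {ffun 'I_d -> 'I_2} | nonzero b && (#|support_set b| <= s)%N)
      family_term nu2 b y.
  by move=> y01; rewrite -[LHS]rep1// -[RHS]rep2.
have c12 : c1 = c2.
  have /sumE : unit_cube (0 : 'rV[R]_d) by move=> j; rewrite mxE lexx ler01.
  rewrite !big1 ?addr0// => b /andP[nb _]; move: nb;
    rewrite nonzero_support => /finset.set0Pn[j jb];
    apply: (family_term0 _ jb); exact: mxE.
have [k] := ubnP #|support_set a|.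
elim: k a x => // k IH a x; rewrite ltnS => ak na sa x01.
set S := support_set a in ak sa *.
have p01 : unit_cube (proj S x).
  by move=> j; rewrite mxE; case: ifP => _; [exact: x01|rewrite lexx ler01].
have := sumE _ p01; rewrite c12 => /addrI.
rewrite (bigD1 a) ?na//= [RHS](bigD1 a) ?na//= !family_term_proj.
suff -> : \sum_(b : {ffun 'I_d -> 'I_2} |
      (nonzero b && (#|support_set b| <= s)%N) && (b != a))
        family_term nu1 b (proj S x) =
    \sum_(b : {ffun 'I_d -> 'I_2} |
      (nonzero b && (#|support_set b| <= s)%N) && (b != a))
        family_term nu2 b (proj S x) by move/addIr.
apply: eq_bigr => b /andP[/andP[nb sb] ba].
have [bS|/fintype.subsetPn[j jb jS]] := boolP (support_set b \subset S).
  apply: IH => //; apply: leq_trans ak; apply: proper_card.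
  rewrite finset.properEneq bS andbT; apply: contra ba => /eqP ba.
  by rewrite -(index1_support b) -(index1_support a) ba.
by rewrite !(family_term0 _ jb)// mxE (negbTE jS).
Qed.

Lemma charge_family_eq s f c1 nu1 c2 nu2 a B :
  mars_represents s f c1 nu1 -> mars_represents s f c2 nu2 ->
  nonzero a -> (#|support_set a| <= s)%N ->
  measurable B -> B `<=` @half_open_cube R #|support_set a| ->
  nu1 a B = nu2 a B.
Proof.
move=> rep1 rep2 na sa mB BH.
have mH := @measurable_half_open_cube R #|support_set a|.
pose L g := charge_integral (nu1 a) (@half_open_cube R _) g -
            charge_integral (nu2 a) (@half_open_cube R _) g.
have bL : bounded_functional L.
  by apply: bounded_functionalB; exact: bounded_functional_charge_integral.
have L0 : L (\1_B) = 0.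
  apply: bounded_functional_hinge0 => //.
  - move=> g h _ _ gh; rewrite /L.
    by rewrite (@charge_integral_ext _ _ _ (nu1 a) _ _ h)//
      (@charge_integral_ext _ _ _ (nu2 a) _ _ h).
  - move=> c c01.
    (* A point of the cube with the prescribed coordinates [c] on the support, so that the hinge
       product with parameters [c] is the integrand of the term at [x]. *)
    pose x := row_of (extension (support_set a) [tuple c i | i < #|support_set a|]).
    have xE i : x 0 (enum_val i) = c i.
      rewrite mxE (tnth_extension [tuple c i | i < _] (enum_valP i)) tnth_mktuple.
      by rewrite enum_valK_in.
    have x01 : unit_cube x.
      move=> j; have [ja|ja] := boolP (j \in support_set a).
        by rewrite -(enum_rankK_in ja ja) xE.
      by rewrite mxE tnth_extensionN// lexx ler01.
    have := family_term_eq rep1 rep2 na sa x01; rewrite /family_term /L.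
    have E nu : charge_integral (nu a) (@half_open_cube R #|support_set a|)
        (fun t => \prod_(i < #|support_set a|)
          Num.max (x 0 (enum_val i) - (tnth t i : R)) 0) =
        charge_integral (nu a) (@half_open_cube R #|support_set a|)
          (fun u => \prod_i hinge_kernel (c i) (tnth u i)).
      apply: charge_integral_ext => u uH; rewrite -hinge_prodE//.
      by apply: eq_bigr => i _; rewrite xE.
    by rewrite !E => ->; rewrite subrr.
  - exact: bm_indic.
move: L0; rewrite /L !charge_integral_indic// setIidl// => /eqP.
rewrite subr_eq0 => /eqP E.
by rewrite -[LHS]fineK ?fin_num_measure// E fineK ?fin_num_measure.
Qed.

End charge_family_uniqueness.

(** * Total variation of the representing charges *)

Section total_variation.
Context {R : realType} {d : nat}.
Variable f : 'rV[R]_d -> R.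
Hypothesis smooth1 : forall a : {ffun 'I_d -> 'I_2},
  mderiv_continuous a unit_cube f.
Hypothesis smooth2 : forall a : {ffun 'I_d -> 'I_2}, nonzero a ->
  forall b : {ffun 'I_d -> 'I_3}, b \in Jset a ->
  mderiv_continuous b (face a) f.
Implicit Types (S A : {set 'I_d}) (x : 'rV[R]_d) (t : euclid R d).

Lemma restrictionK S (u : euclid R #|S|) : restriction S (extension S u) = u.
Proof.
apply: eq_from_tnth => i; rewrite tnth_mktuple (tnth_extension _ (enum_valP i)).
by rewrite enum_valK_in.
Qed.

Definition piece_support S A : set (euclid R #|S|) :=
  [set u | open_face A (extension S u)].

Lemma measurable_piece_support S A : measurable (@piece_support S A).
Proof.
rewrite -[X in measurable X]setTI; apply: measurable_extension => //.
exact: measurable_open_face.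
Qed.

Lemma piece_support_sub S A : @piece_support S A `<=` @half_open_cube R #|S|.
Proof.
by move=> u uA; rewrite -[u]restrictionK; exact: open_face_half_open_cube uA.
Qed.

Lemma piece_support_restriction S A t : A \subset S -> open_face A t ->
  piece_support A (restriction S t).
Proof. by move=> AS At; rewrite /piece_support /= (open_face_extensionK AS At). Qed.

Lemma trivIset_piece_support S (P : set {set 'I_d}) :
  trivIset P (@piece_support S).
Proof.
move=> A B _ _ [u [uA uB]]; apply/finset.setP => j.
have := uA j; have := uB j; case: (j \in A); case: (j \in B) => //.
  by move=> -> /andP[]; rewrite ltxx.
by move=> + u0; rewrite u0 ltxx.
Qed.

(** The piece containing a point is indexed by its nonzero coordinates; this set is empty only at
    the origin. *)
Lemma half_open_cubeD1 S :
  @half_open_cube R #|S| `\ origin #|S| =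
  \bigcup_(A in [set` (fun A : {set 'I_d} => (A \subset S) && (A != finset.set0))])
    @piece_support S A.
Proof.
apply/seteqP; split => u.
  move=> [uH u0]; pose A := [set j | tnth (extension S u) j != 0 :> R]%SET.
  have AS : A \subset S.
    apply/fintype.subsetP => j; rewrite inE; apply: contraR => jS.
    by rewrite tnth_extensionN.
  exists A.
    apply/andP; split=> //; apply: contra_notN u0 => /eqP A0 /=.
    apply: eq_from_tnth => i; rewrite -[u]restrictionK tnth_mktuple.
    have : enum_val i \notin A by rewrite A0 finset.in_set0.
    rewrite inE negbK => /eqP ->.
    by rewrite (tnth_nth 0) /= nth_nseq ltn_ord.
  move=> j; case: ifPn; rewrite inE; last by rewrite negbK => /eqP.
  move=> uj; have jS : j \in S by apply: (fintype.subsetP AS); rewrite inE.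
  move: uj; rewrite (tnth_extension _ jS) => uj.
  by have /andP[u0' ->] := uH (enum_rank_in jS j); rewrite andbT lt_neqAle eq_sym uj.
move=> [A /andP[AS /finset.set0Pn[j jA]] uA]; split; first exact: piece_support_sub uA.
move=> /= u0; have := uA j; rewrite jA.
rewrite (tnth_extension _ (fintype.subsetP AS _ jA)) u0 (tnth_nth 0) /=.
by rewrite nth_nseq ltn_ord ltxx.
Qed.

Lemma face_pieceC0 S A : A \subset S -> face_piece S A (~` piece_support A) = 0%E.
Proof.
move=> AS; rewrite /= /finite_pushforward /pushforward.
have mC := measurableC (@measurable_piece_support S A).
apply/eqP; rewrite -measure_le0 -(face_measure_open A); apply: le_measure.
- rewrite inE -[X in measurable X]setTI.
  exact: (measurable_restriction (S := S)).
- rewrite inE; apply: measurableC; exact: measurable_open_face.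
- by move=> t /= tC At; apply: tC; exact: piece_support_restriction.
Qed.

(** The maximum 2 of the index is reached exactly on [A]. Points of the closed face of [A] are in
    the cube and fixed by [proj S], so the cut-off and the projection in [density2] change nothing
    there. *)
Lemma face_integral_density2 S A : S != finset.set0 -> A \subset S ->
  A != finset.set0 ->
  face_integral_abs (index2 S A) (mderiv (index2 S A) f) =
  (\int[face_measure A]_t `|density2 f S A t|%:E)%E.
Proof.
move=> S0 AS A0; rewrite /face_integral_abs.
have bd := bm_norm (bm_density2 smooth1 smooth2 A S0).
have mC := max_coords_index2 AS A0.
have mh : measurable_fun setT (fun t => `|density2 f S A t|%:E).
  by apply/measurable_EFinP; case: bd.
have h0 t : (0 <= `|density2 f S A t|%:E)%E by rewrite lee_fin.
(* [A] is expanded to [max_coords (index2 S A)] and not the converse, because the type of the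
   integration variable depends on the latter. *)
rewrite -[in face_measure A]mC -(integral_face_measure erefl mh h0).
apply: eq_integral => u; rewrite inE => u01.
rewrite /density2 AS -deriv2E.
set M := max_coords (index2 S A) in u u01 *.
have cu : closed_cube (extension M u).
  move=> j; have [jM|jM] := boolP (j \in M); last first.
    by rewrite tnth_extensionN ?lexx ?ler01.
  by rewrite (tnth_extension _ jM); exact: u01.
rewrite indicE mem_set// mulr1; congr (`|deriv2 f S A _|%:E).
apply/rowP => j; rewrite !mxE tnth_mktuple; case: ifPn => // jS.
rewrite nth_default// size_tuple cardE memNindex// mem_enum /M mC.
by apply: contra jS; exact: (fintype.subsetP AS).
Qed.

Lemma charge_tv_pieces S nu : S != finset.set0 -> piece_charge f (S := S) nu ->
  charge_tv nu (@half_open_cube R #|S| `\ origin #|S|) =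
  (\sum_(A : {set 'I_d} | (A \subset S) && (A != finset.set0))
     face_integral_abs (index2 S A) (mderiv (index2 S A) f))%E.
Proof.
move=> S0 nuE; rewrite half_open_cubeD1 charge_tv_bigcup; last 2 first.
- by move=> A _; exact: measurable_piece_support.
- exact: trivIset_piece_support.
apply: eq_bigr => A /andP[AS A0].
have mE := @measurable_piece_support S A.
have bp B := bm_piece_density smooth1 smooth2 B S0.
have bd := bm_norm (bm_density2 smooth1 smooth2 A S0).
rewrite face_integral_density2// (charge_tv_density (m := face_piece S A) mE (bp A)).
  rewrite -[LHS]fineK; last first.
    apply: integrable_fin_num => //; apply: bm_integrable => //.
    exact: bm_norm.
  rewrite -[RHS]fineK; last first.
    by apply: integrable_fin_num => //; exact: bm_integrable.
  congr EFin; apply: (@Rintegral_face_piece _ _ _ _ _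
    (fun u => `|piece_density f A u|)) => //.
  - exact: bm_norm.
  - by move=> t At; exact: piece_support_restriction.
  - by move=> t At; rewrite /piece_density (open_face_extensionK AS At).
move=> B mB BE; rewrite nuE//; last by apply: subset_trans BE _; exact: piece_support_sub.
(* On the support of piece [A] the others contribute nothing: the density is 0 if [A'] is not
   included in [S], and otherwise the measure is carried by a disjoint set. *)
rewrite (bigD1 A)//= big1 ?addr0// => A' A'A.
have [A'S|A'S] := boolP (A' \subset S); last first.
  under eq_Rintegral do rewrite piece_density_out//.
  by rewrite Rintegral_cst// mul0r.
rewrite /Rintegral null_set_integral//.
  by apply/measurable_EFinP/measurable_funTS; case: (bp A').
apply/eqP; rewrite -measure_le0 -(face_pieceC0 A'S); apply: le_measure.
- by rewrite inE.
- by rewrite inE; apply: measurableC; exact: measurable_piece_support.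
move=> u /BE uA uA'; move/negP: A'A; apply; apply/eqP.
by apply: (@trivIset_piece_support S setT) => //; exists u.
Qed.

End total_variation.

(** * Sums over multi-indices of maximum 2 *)

Section index_sums.
Context {d : nat}.
Implicit Types (a : {ffun 'I_d -> 'I_2}) (b : {ffun 'I_d -> 'I_3}).

(** The support of an index in [Jset a] is fixed by [a]; only the set where it equals 2 is free. *)
Lemma index2_max_coords a b : b \in Jset a ->
  index2 (support_set a) (max_coords b) = b.
Proof.
rewrite inE => /andP[/eqP b2 /forallP ab]; apply/ffunP => j; apply/val_inj.
rewrite /= index2E [j \in max_coords b]inE b2.
by have := ab j; case: ifP => _; [move=> /orP[]|] => /eqP ->.
Qed.

Lemma index2_JsetP a A : index2 (support_set a) A \in Jset a ->
  (A \subset support_set a) && (A != finset.set0).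
Proof.
rewrite inE => /andP[/eqP b2 /forallP ab]; apply/andP; split.
  apply/fintype.subsetP => j jA; have := ab j; case: ifPn => // ja.
  by rewrite index2E jA (negbTE ja).
apply: contra_eqN b2 => /eqP ->; rewrite neq_ltn; apply/orP; left.
rewrite ltnS; apply/bigmax_leqP => j _.
by rewrite index2E finset.in_set0 addn0; case: (_ \in _).
Qed.

Lemma big_Jset (V : Type) (idx : V) (op : Monoid.com_law idx) a
    (F : {ffun 'I_d -> 'I_3} -> V) :
  \big[op/idx]_(b in Jset a) F b =
  \big[op/idx]_(A : {set 'I_d} | (A \subset support_set a) && (A != finset.set0))
    F (index2 (support_set a) A).
Proof.
rewrite (reindex_onto (index2 (support_set a)) (@max_coords d 3)) => [|b]; last first.
  exact: index2_max_coords.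
apply: eq_bigl => A; apply/andP/idP => [[/index2_JsetP //]|].
move=> /andP[AS A0]; rewrite max_coords_index2// eqxx; split=> //.
by have := index2_Jset AS A0; rewrite index1_support.
Qed.

Definition index_support b : {ffun 'I_d -> 'I_2} :=
  [ffun j => inord (b j != 0%N :> nat)].

Lemma mem_Jset a b :
  (b \in Jset a) = (max_order b == 2) && (index_support b == a).
Proof.
rewrite inE; congr (_ && _); apply/forallP/eqP => [ab|<- j]; last first.
  rewrite inE ffunE inordK; last by rewrite ltnS; case: (_ != _).
  by case: (b j) => -[|[|[|]]].
apply/ffunP => j; apply/val_inj; rewrite /= ffunE inordK; last by case: (_ != _).
have := ab j; rewrite inE; case: (a j) => -[|[|//]] /= _.
  by move=> /eqP ->.
by move=> /orP[] /eqP ->.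
Qed.

(** Each index of maximum 2 lies in exactly one [Jset a], that of its support. The bound [d] on the
    cardinality gives the sum the shape of the second claim at [s = d]. *)
Lemma big_max_order2 (V : Type) (idx : V) (op : Monoid.com_law idx)
    (F : {ffun 'I_d -> 'I_3} -> V) :
  \big[op/idx]_(b | max_order b == 2) F b =
  \big[op/idx]_(a : {ffun 'I_d -> 'I_2} | nonzero a && (#|support_set a| <= d)%N)
    \big[op/idx]_(b in Jset a) F b.
Proof.
rewrite (partition_big index_support
  (fun a => nonzero a && (#|support_set a| <= d)%N)) /=.
  by apply: eq_bigr => a _; apply: eq_bigl => b; rewrite mem_Jset.
move=> b /eqP b2; rewrite -[X in (_ <= X)%N]card_ord max_card andbT.
apply/existsP; have [j] : exists j, b j != 0%N :> nat.
  apply/existsP; apply: contra_eqT b2 => /existsPn b0.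
  rewrite neq_ltn; apply/orP; left; rewrite ltnS; apply/bigmax_leqP => j _.
  by have := b0 j; rewrite negbK => /eqP ->.
by move=> bj; exists j; rewrite ffunE inordK bj.
Qed.

End index_sums.

Theorem lemma4p3 (R : realType) (d : nat) (d_gt0 : (0 < d)%N)
    (f : 'rV[R]_d -> R)
    (smooth1 : forall a : {ffun 'I_d -> 'I_2},
       mderiv_continuous a unit_cube f)
    (smooth2 : forall a : {ffun 'I_d -> 'I_2}, nonzero a ->
       forall b : {ffun 'I_d -> 'I_3}, b \in Jset a ->
       mderiv_continuous b (face a) f) :
  (mars_class d f /\
   Vmars d f =
     (\sum_(b : {ffun 'I_d -> 'I_3} | max_order b == 2%N)
        face_integral_abs b (mderiv b f))%E) /\
  (forall s : nat, (1 <= s <= d)%N ->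
    (forall a : {ffun 'I_d -> 'I_2}, (s < #|support_set a|)%N ->
       forall x : 'rV[R]_d, unit_cube x -> mderiv a f x = 0) ->
    mars_class s f /\
    Vmars s f =
      (\sum_(a : {ffun 'I_d -> 'I_2} | nonzero a && (#|support_set a| <= s)%N)
         \sum_(b in Jset a) face_integral_abs b (mderiv b f))%E).
Proof.
(* Both claims are instances of one statement; at [s = d] the vanishing condition concerns supports
   with more than [d] elements, and there are none. *)
have main s : (forall a : {ffun 'I_d -> 'I_2}, (s < #|support_set a|)%N ->
       forall x : 'rV[R]_d, unit_cube x -> mderiv a f x = 0) ->
    mars_class s f /\
    Vmars s f =
      (\sum_(a : {ffun 'I_d -> 'I_2} | nonzero a && (#|support_set a| <= s)%N)
         \sum_(b in Jset a) face_integral_abs b (mderiv b f))%E.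
  move=> f0; have [nu0 nu0E] := piece_family_exists smooth1 smooth2.
  have rep0 := piece_family_represents smooth1 smooth2 nu0E f0.
  split; first by exists (f 0), nu0.
  have V1 : exists v, [set v | exists (a0 : R) nu, mars_represents s f a0 nu /\
      v = mars_complexity s nu] v.
    by exists (mars_complexity s nu0), (f 0), nu0.
  (* The value selected by [get] comes from some representation [nu], possibly different from [nu0].
     By uniqueness the two agree inside the half-open cube, so [nu] has the same pieces and hence
     the same variation. *)
  have [a0 [nu [rep vE]]] := getPex V1.
  transitivity (mars_complexity s nu); first exact: vE.
  apply: eq_bigr => a /andP[na sa]; rewrite big_Jset.
  have S0 : support_set a != finset.set0 by rewrite -nonzero_support.
  apply: (charge_tv_pieces smooth1 smooth2 S0) => B mB BH.
  by rewrite (charge_family_eq rep rep0 na sa mB BH) nu0E.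
split; last by move=> s _; exact: main.
rewrite big_max_order2; apply: main => a.
by rewrite ltnNge -[X in (_ <= X)%N]card_ord max_card.
Qed.
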